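(* Let $k$ be a field, let $n\ge 3$, and let $a_1<a_2<\dots<a_n$ be integers. Let $R=k[z_1,\dots,z_n]$, let $\psi: R\to k[y_1,y_2,y_2^{-1}]$ be the $k$-algebra homomorphism with $\psi(z_j)=y_1y_2^{a_j}$ for $1\le j\le n$, and let $I=\ker\psi$. Let $r\ge s$ be the two largest of the successive differences $a_i-a_{i-1}$ ($2\le i\le n$). Then the ideal $I$ is generated by elements of degree no more than $r+s$.
   Context: $I$ is the toric ideal of the $2\times n$ integer matrix with first row $(1,\dots,1)$ and second row $(a_1,\dots,a_n)$. Degree means degree in the usual $\mathbb{N}$-grading on $R$, in which every $z_j$ has degree $1$; the ideal $I$ is homogeneous for this grading. The two largest differences are counted with multiplicity: if the largest difference occurs more than once, then $r=s$. *)

(* Defs.v *)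
From mathcomp Require Export all_boot all_order all_algebra.
From mathcomp Require Export fraction.
From mathcomp Require Export mpoly.

Set Implicit Arguments.
Unset Strict Implicit.
Unset Printing Implicit Defensive.

Import Order.TTheory GRing.Theory Num.Theory.

Local Open Scope ring_scope.

Definition gaps (a : seq int) : seq int :=
  [seq a`_i.+1 - a`_i | i <- iota 0 (size a).-1].

(* Decreasing, with repetitions: entries 0 and 1 are the two largest gaps,
   counted with multiplicity. *)
Definition sorted_gaps (a : seq int) : seq int :=
  sort (fun x y : int => y <= x) (gaps a).

Definition ideal_gen (R : comNzRingType) (G : R -> Prop) (x : R) : Prop :=
  exists (m : nat) (c g : 'I_m -> R),
    (forall i, G (g i)) /\ x = \sum_(i < m) c i * g i.

Section ToricMap.
Variables (k : fieldType) (n : nat) (a : n.-tuple int).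

(* k(y1, y2), in which k[y1, y2, 1/y2] is the subring [laurent] below. *)
Definition ratfun : fieldType := {fraction {mpoly k[2]}}.

Definition y1 : ratfun := tofrac ('X_(inord 0) : {mpoly k[2]}).
Definition y2 : ratfun := tofrac ('X_(inord 1) : {mpoly k[2]}).

Definition laurent (x : ratfun) : Prop :=
  exists (p : {mpoly k[2]}) (m : nat), x = tofrac p / y2 ^+ m.

(* The k-algebra morphism psi.  Its values lie in k[y1, y2, 1/y2], see
   [toric_map_laurent], so its kernel does not depend on whether its codomain
   is taken to be that subring or k(y1, y2). *)
Definition toric_map (p : {mpoly k[n]}) : ratfun :=
  mmap (fun c : k => tofrac (c%:MP_[2])) (fun j => y1 * y2 ^ (tnth a j)) p.

Definition toric_ideal (p : {mpoly k[n]}) : Prop := toric_map p = 0.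

Let cst : {rmorphism k -> ratfun} :=
  (@tofrac {mpoly k[2]} \o @mpolyC 2 k).

Lemma toric_map_zmod_morphism : zmod_morphism toric_map.
Proof. exact: (raddfB (mmap cst _)). Qed.

Lemma toric_map_monoid_morphism : monoid_morphism toric_map.
Proof. by split; [exact: (rmorph1 (mmap cst _)) | exact: (rmorphM (mmap cst _))]. Qed.

Lemma toric_mapC (c : k) : toric_map c%:MP = tofrac (c%:MP_[2]).
Proof. by rewrite [LHS](mmapC _ cst). Qed.

Lemma toric_mapX (j : 'I_n) : toric_map 'X_j = y1 * y2 ^ (tnth a j).
Proof. by rewrite [LHS](mmapX _ cst) mmap1U. Qed.

Lemma y2_neq0 : y2 != 0.
Proof. by rewrite tofrac_eq0 -msize_poly_eq0 msizeX mdeg1. Qed.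

Lemma laurentD x y : laurent x -> laurent y -> laurent (x + y).
Proof.
move=> [p [m ->]] [q [l ->]].
exists (p * 'X_(inord 1) ^+ l + q * 'X_(inord 1) ^+ m), (m + l)%N.
have h i : y2 ^+ i != 0 by rewrite expf_neq0 ?y2_neq0.
by rewrite addf_div ?h // rmorphD !rmorphM !rmorphXn exprD.
Qed.

Lemma laurentM x y : laurent x -> laurent y -> laurent (x * y).
Proof.
move=> [p [m ->]] [q [l ->]]; exists (p * q), (m + l)%N.
by rewrite rmorphM exprD invfM mulrACA.
Qed.

Lemma laurent_tofrac (p : {mpoly k[2]}) : laurent (tofrac p).
Proof. by exists p, 0%N; rewrite expr0 divr1. Qed.

Lemma laurent_toric_var (j : 'I_n) : laurent (y1 * y2 ^ (tnth a j)).
Proof.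
apply: laurentM; first exact: laurent_tofrac.
case: (tnth a j) => m.
  by rewrite -exprnP -[_ ^+ _]rmorphXn; apply: laurent_tofrac.
by exists 1, m.+1; rewrite rmorph1 mul1r.
Qed.

Lemma toric_map_laurent p : laurent (toric_map p).
Proof.
rewrite /toric_map /mmap.
elim/big_ind: _ => [||m _]; [|exact: laurentD|].
  by rewrite -(rmorph0 (@tofrac {mpoly k[2]})); apply: laurent_tofrac.
apply: laurentM; first exact: laurent_tofrac.
have h1 : laurent 1.
  by rewrite -(rmorph1 (@tofrac {mpoly k[2]})); apply: laurent_tofrac.
rewrite /mmap1; elim/big_ind: _ => [//||j _]; first exact: laurentM.
elim: (m j) => [//|i IHi]; rewrite exprS.
by apply: laurentM => //; apply: laurent_toric_var.
Qed.

End ToricMap.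

(* Main.v *)
Require Import Defs.
From HB Require Import structures.
From mathcomp Require Import zify.

Set Implicit Arguments.
Unset Strict Implicit.
Unset Printing Implicit Defensive.

Import Order.TTheory GRing.Theory Num.Theory.
Local Open Scope ring_scope.

(** Subtracting the first exponent from all of them changes the weight of a
monomial of given degree by a constant, so let the exponents be
[0 = a_0 < ... < a_l = D], and put [N = r + s].  Any two different gaps of this
sequence add up to at most [N], and [N <= D].

The kernel is spanned by the binomials [X^m - X^m'] with [m] and [m'] of the
same degree and weight ([toric_kernel]): such monomials have the same image, and
different images of monomials are linearly independent.  If [m] and [m'] share a
variable, the binomial is a multiple of one of smaller degree.  Hence it
suffices that, in degree above [N], any two monomials of the same degree and
weight are joined by a chain in which consecutive monomials share a variable
([fibre_connected]).  Two facts on sums of exponents give this.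
- [sums_end]: a sum of [m >= N] exponents can be written with [0] or [D] among
  them.  Applied to a monomial deprived of one variable, it joins the monomial
  to one that contains an extreme variable.
- [sums_both]: if a sum of [m > N] exponents can be written with [0] and also
  with [D], it can be written with both at once.  So the monomials that contain
  the first variable are joined to those that contain the last.

Both come from counting in a window of length [N].  Let [P m w] be the set of
[p < N] such that [w - p] is a sum of [m] exponents.  From any point of the
window and for two different gaps, one can go up by the first or down by the
second without leaving the window.  And if a subset of the window is stable
under going up by one gap and down by another, it is stable under the opposite
moves too, because the two moves together generate a rotation ([rotation]).

The first fact is [growth]: if [q] is in [P m w] but no way of writing [w - q]
uses [0] or [D], then at least [m] points [p] of the window admit such a way of
writing [w - p].  The set of these points gains a point each time the degree
increases, since otherwise it would be stable under the two gaps next to some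
exponent, hence under their opposites, and one could go from the set to a
point outside it.  As [q] itself is excluded, [m < N].

The second fact is [hole_flat_bounds], proved by induction on the degree: a
hole, that is a point which is in [P (m + 1) w] and in [P (m + 1) (w + D)] but
not in [P m w], forces [m + 1] points other than holes, and together with the
hole they do not fit into the window if [m + 1 >= N].  Take the hole which
survives the removal of as many copies of one extreme exponent as possible.
There [growth] applies, and one puts the copies back one at a time
([ladder]).  Each step gains a point unless it meets a hole of smaller degree,
where the induction hypothesis is enough, or it leaves the set unchanged.  In
the latter case the set changes at some later step, and a companion statement
([flat_bound]) shows that a set that pauses and then grows is already large.
The companion is proved by the same climb along the other extreme exponent.
Its one new case is a set unchanged by both extreme exponents, which [core]
shows to be periodic, with a period that divides all exponents; such a set
cannot grow any more ([flat_both]). *)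

(** * Sums of exponents *)

Section Sumsets.

Variables (l : nat) (a : nat -> int) (N : nat).
Hypothesis l_gt1 : (1 < l)%N.
Hypothesis a0 : a 0%N = 0.
Hypothesis a_incr : forall i, (i < l)%N -> a i < a i.+1.
Hypothesis two_gaps : forall i j, (i < l)%N -> (j < l)%N -> i != j ->
  (a i.+1 - a i) + (a j.+1 - a j) <= N%:Z.
Hypothesis N_le : N%:Z <= a l.

Local Notation D := (a l).

Fixpoint nsums (m : nat) (w : int) : bool :=
  if m is m'.+1 then [exists i : 'I_l.+1, nsums m' (w - a i)] else w == 0.

(** A degree in [int] lets the inductions below subtract from it freely; there
are no sums of negative degree. *)
Definition sums (m w : int) : bool := if m is Posz k then nsums k w else false.

Lemma sumsD i m w : (i <= l)%N -> sums m w -> sums (m + 1) (w + a i).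
Proof.
move=> li; case: m => // k sw.
have -> : Posz k + 1 = Posz k.+1 by lia.
by apply/existsP; exists (Ordinal (li : (i < l.+1)%N)); rewrite /= addrK.
Qed.

Lemma sums_ge0 m w : sums m w -> 0 <= m.
Proof. by case: m. Qed.

Lemma sums_split m w : 0 < m -> sums m w ->
  exists2 i, (i <= l)%N & sums (m - 1) (w - a i).
Proof.
case: m => // -[|k] // _ /existsP[i si]; exists i; first by rewrite -ltnS.
by have -> : Posz k.+1 - 1 = Posz k by lia.
Qed.

Lemma a_mono i j : (i <= j)%N -> (j <= l)%N -> a i <= a j.
Proof.
elim: j => [|j IHj]; first by rewrite leqn0 => /eqP->.
rewrite leq_eqVlt ltnS => /orP[/eqP-> //|/IHj lij] jl.
by have := a_incr jl; have := lij (ltnW jl); lia.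
Qed.

Lemma a_bound i : (i <= l)%N -> 0 <= a i <= D.
Proof. by move=> li; rewrite -{1}a0 !a_mono. Qed.

Lemma a_inner i : (0 < i)%N -> (i < l)%N -> 1 <= a i <= D - 1.
Proof.
move=> i0 li; have l0 : (0 < l)%N by lia.
have := a_incr li; have := a_mono li (leqnn l).
have := a_incr l0; have := a_mono i0 (ltnW li); rewrite a0; lia.
Qed.

Lemma sums_bound m w : sums m w -> 0 <= w <= m * D.
Proof.
case: m => // k; elim: k w => [|k IHk] w /=; first by move=> /eqP->; lia.
case/existsP=> i /IHk; have := a_bound (ltn_ord i : (i <= l)%N); nia.
Qed.

Definition inner m w := [&& sums m w, ~~ sums (m - 1) w & ~~ sums (m - 1) (w - D)].

(** An end that could be used after the removal of one exponent could also be
used before it, so the remaining sum is still inner. *)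
Lemma inner_split m w : 0 < m -> inner m w ->
  exists i, [/\ (0 < i)%N, (i < l)%N & inner (m - 1) (w - a i)].
Proof.
move=> m0 /and3P[sw nw nwD]; have [i li si] := sums_split m0 sw.
have i0 : (0 < i)%N.
  by case: i si {li} => // si; rewrite a0 subr0 in si; rewrite si in nw.
have il : (i < l)%N.
  by rewrite ltn_neqAle li andbT; apply: contraNneq nwD => il; rewrite -il.
exists i; split=> //; apply/and3P; split=> //.
  by apply: contraNN nw => /(sumsD li); rewrite !subrK.
apply: contraNN nwD => /(sumsD li).
by rewrite subrK addrAC subrK.
Qed.

(** Only exponents between [1] and [D - 1] are ever removed. *)
Lemma inner_bound m w : inner m w -> m <= w <= m * (D - 1).
Proof.
case: m => [k|k]; last by case/and3P.
elim: k w => [|k IHk] w; first by case/and3P=> /eqP -> _ _; lia.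
move=> /inner_split -/(_ isT) [i [i0 il]].
have -> : Posz k.+1 - 1 = Posz k by lia.
by move/IHk; have := a_inner i0 il; nia.
Qed.

(** * The window *)

(** The window has length [N], so that a point of it can be moved up by one gap
or down by a different gap. *)
Definition P (m w : int) : {set 'I_N} := [set p : 'I_N | sums m (w - (p : nat)%:Z)].

Lemma P_mono i m w : (i <= l)%N -> P m w \subset P (m + 1) (w + a i).
Proof.
by move=> li; apply/subsetP=> p; rewrite !inE => /(sumsD li); rewrite addrAC.
Qed.

Lemma P_neg m w : m < 0 -> P m w = set0.
Proof. by case: m => // k _; apply/setP=> p; rewrite !inE. Qed.

Lemma gap_le i : (i < l)%N -> a i.+1 - a i < N%:Z.
Proof.
move=> il.
have [j [jl ij]] : exists j, (j < l)%N /\ i != j.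
  by case: i il => [|i] il; [exists 1%N | exists 0%N]; split=> //; lia.
by have := two_gaps il jl ij; have := a_incr jl; lia.
Qed.

Lemma cover1 w : 0 <= w -> w - N%:Z < D ->
  exists i, [/\ (i <= l)%N, 0 <= w - a i & w - a i < N%:Z].
Proof.
move=> w0 wD; suff H k : (k <= l)%N -> w - N%:Z < a k ->
    exists i, [/\ (i <= l)%N, 0 <= w - a i & w - a i < N%:Z] by apply: (H l).
elim: k => [|k IHk] kl wk; first by exists 0%N; rewrite a0 in wk *; split; lia.
case: (lerP (a k.+1) w) => h; first by exists k.+1; split=> //; lia.
by apply: IHk; [exact: ltnW | have := gap_le kl; lia].
Qed.

(** Degree [1] holds because no gap exceeds [N].  For larger degrees, one of the
windows at [w] and [w - D] is in reach of one summand less, because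
[N <= D]. *)
Lemma P_neq0 m w : 0 <= m -> 0 <= w -> w - N%:Z < m * D -> P m w != set0.
Proof.
case: m => // k _; elim: k w => [|k IHk] w w0 wk.
  have wN : (`|w| < N)%N by lia.
  apply/set0Pn; exists (Ordinal wN); rewrite inE /=.
  by rewrite gez0_abs // subrr.
have e : Posz k.+1 = Posz k + 1 by lia.
case: (ltrP (w - N%:Z) (k%:Z * D)) => h.
  have := IHk w w0 h; apply: contraNneq => P0.
  by rewrite -subset0 -P0 e -{2}[w]addr0 -a0 P_mono.
case: (posnP k) => [k0|k_gt0].
  have [i [il wi wiN]] : exists i, [/\ (i <= l)%N, 0 <= w - a i & w - a i < N%:Z].
    by apply: cover1 => //; move: wk; rewrite k0 mul1r.
  have wN : (`|w - a i| < N)%N by lia.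
  apply/set0Pn; exists (Ordinal wN); rewrite inE /= k0.
  apply/existsP; exists (Ordinal (il : (i < l.+1)%N)) => /=.
  by rewrite gez0_abs //; apply/eqP; lia.
have wD : 0 <= w - D by move: N_le h (a_bound (leqnn l)); nia.
have wk' : w - D - N%:Z < k%:Z * D by move: wk; rewrite e mulrDl; lia.
have := IHk _ wD wk'; apply: contraNneq => P0.
by rewrite -subset0 -P0 e -{2}[w](subrK D) P_mono.
Qed.

Definition shift_closed (T : {set 'I_N}) (d : int) :=
  forall p q : 'I_N, p \in T -> (q : nat)%:Z = (p : nat)%:Z + d -> q \in T.

(** On the block [[o, o + g + h)] the partial maps [x -> x - g] and [x -> x + h]
combine into the rotation by [h] modulo [g + h], which is total on the block.
A stable set is closed under it, hence under its inverse, which is a power of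
it; and the inverse moves up by [g] or down by [h]. *)
Lemma rotation_orbit (T : {set 'I_N}) (g h o : nat) (p q : 'I_N) :
    (0 < h)%N -> (o + (g + h) <= N)%N ->
    shift_closed T (- g%:Z) -> shift_closed T h%:Z ->
    (o <= p < o + (g + h))%N -> (o <= q < o + (g + h))%N ->
    (p + g = q \/ q + h = p)%N -> p \in T -> q \in T.
Proof.
set M := (g + h)%N => h0 oM Tg Th hp hq pq Tp.
have M0 : (0 < M)%N by rewrite /M; lia.
(* The k-th point of the orbit of p, counted from the start o of the block. *)
pose x k := (((p - o) + k * h) %% M)%N.
have xM k : (x k < M)%N by rewrite ltn_mod.
have xN k : (o + x k < N)%N by have := xM k; lia.
have orbit k : Ordinal (xN k) \in T.
  elim: k => [|k IHk].
    suff -> : Ordinal (xN 0%N) = p by [].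
    by apply: val_inj; rewrite /= /x mul0n addn0 modn_small; lia.
  have e : x k.+1 = ((x k + h) %% M)%N.
    by rewrite /x modnDml mulSn -addnA [(h + _)%N]addnC.
  have [lt_xg|le_gx] := ltnP (x k) g.
    by apply: (Th _ _ IHk); rewrite /= e modn_small; lia.
  apply: (Tg _ _ IHk); rewrite /= e.
  have -> : (x k + h = x k - g + M)%N by rewrite /M; lia.
  by rewrite modnDr modn_small; have := xM k; lia.
(* M steps of the rotation return to p, so M - 1 steps undo one. *)
suff e : x M.-1 = (q - o)%N.
  have -> : q = Ordinal (xN M.-1) by apply: val_inj; rewrite /= e; lia.
  exact: orbit.
rewrite /x; case: pq => pq.
  have -> : (p - o + M.-1 * h = (h - 1) * M + (q - o))%N by rewrite /M; nia.
  by rewrite modnMDl modn_small; lia.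
have -> : (p - o + M.-1 * h = h * M + (q - o))%N by rewrite /M; nia.
by rewrite modnMDl modn_small; lia.
Qed.

(** Any two points of the window that differ by [g] or by [h] lie in a common
block of length [g + h]. *)
Lemma rotation (T : {set 'I_N}) (g h : int) :
    0 < g -> 0 < h -> g + h <= N%:Z ->
    shift_closed T (- g) -> shift_closed T h ->
  shift_closed T g /\ shift_closed T (- h).
Proof.
case: g h => // g [] // h g0 h0 ghN Tg Th; split=> p q Tp pq.
  apply: (@rotation_orbit T g h (minn p (N - (g + h))) p q) => //; try lia.
    by have := ltn_ord p; have := ltn_ord q; lia.
  by have := ltn_ord p; have := ltn_ord q; lia.
apply: (@rotation_orbit T g h (minn q (N - (g + h))) p q) => //; try lia.
  by have := ltn_ord p; have := ltn_ord q; lia.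
by have := ltn_ord p; have := ltn_ord q; lia.
Qed.

(** * Growth of the points that use an end *)

Lemma sumsE m w m' w' : m = m' -> w = w' -> sums m w -> sums m' w'.
Proof. by move=> -> ->. Qed.

Definition ends (m w : int) : {set 'I_N} := P (m - 1) w :|: P (m - 1) (w - D).

Lemma ordW (x : int) : 0 <= x -> x < N%:Z -> {p : 'I_N | (p : nat)%:Z = x}.
Proof.
move=> x0 xN; have xN' : (`|x| < N)%N by lia.
by exists (Ordinal xN'); rewrite /= gez0_abs.
Qed.

Lemma P_shift m w y i (p q : 'I_N) : (i <= l)%N -> p \in P (m - 1) (w - y) ->
  (q : nat)%:Z = (p : nat)%:Z + (y - a i) -> q \in P m w.
Proof.
by move=> il; rewrite !inE => /(sumsD il); rewrite subrK => sw ->; apply: sumsE sw; lia.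
Qed.

Lemma P_sub i m w m' w' : (i <= l)%N -> m' = m + 1 -> w' = w + a i ->
  P m w \subset P m' w'.
Proof. by move=> il -> ->; apply: P_mono. Qed.

Lemma ends_mono m w z : (z <= l)%N -> ends (m - 1) (w - a z) \subset ends m w.
Proof. by move=> zl; apply: setUSS; apply: (P_sub zl); lia. Qed.

(** A point of [ends (m - 1) (w - a z)] keeps its representation when the
exponent [y] is added to it: relative to [w], this moves the point by
[a z - a y].  So if adding [z] brings nothing new, the set is stable under
these moves. *)
Lemma ends_flat m w z y : (z <= l)%N -> (y <= l)%N ->
  ends (m - 1) (w - a z) = ends m w -> shift_closed (ends m w) (a z - a y).
Proof.
move=> zl yl e p q; rewrite -{1}e !inE => /orP[] pP qp.
  by apply/orP; left; move: (@P_shift (m - 1) w (a z) y p q yl); rewrite !inE; apply.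
apply/orP; right; move: (@P_shift (m - 1) (w - D) (a z) y p q yl).
by rewrite !inE [w - D - a z]addrAC; apply.
Qed.

(** Push the two chosen exponents [i <= j] apart, [i] down or [j] up by one
place: the point then moves up by the gap below [i] or down by the gap above
[j], and one of the two stays in the window.  When an exponent reaches an end of
the sequence, the point is in [ends m w]; the step on which the point enters
this set is the one asked for. *)
Lemma spread m w (q : 'I_N) i j :
    (0 < i)%N -> (i <= j)%N -> (j < l)%N -> q \notin ends m w ->
    sums (m - 2) (w - (q : nat)%:Z - a i - a j) ->
  exists (q' p : 'I_N) (z : nat),
    [/\ (0 < z < l)%N, q' \notin ends m w, q' \in P (m - 1) (w - a z),
        p \in ends m w &
        ((p : nat)%:Z = (q' : nat)%:Z + (a z - a z.+1) \/
         (p : nat)%:Z = (q' : nat)%:Z + (a z - a z.-1))].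
Proof.
elim: {i j}(i + (l - j))%N {-2}i {-2}j (leqnn (i + (l - j))) q =>
  [|k IHk] i j hk q i0 ij jl qT sq; first by lia.
have il : (i < l)%N by lia.
have [i' ei] : exists i', i = i'.+1 by exists i.-1; lia.
case: (ltrP ((q : nat)%:Z + (a i - a i.-1)) N%:Z) => h.
  have gi : a i' < a i by rewrite ei; apply: a_incr; lia.
  have [p ep] : {p : 'I_N | (p : nat)%:Z = (q : nat)%:Z + (a i - a i.-1)}.
    by apply: ordW => //; rewrite ei /= -ei; lia.
  have sp : sums (m - 2) (w - (p : nat)%:Z - a i' - a j).
    by apply: sumsE sq => //; rewrite ep ei /=; lia.
  have [pT|pT] := boolP (p \in ends m w).
    exists q, p, i; split=> //; [by rewrite i0 | | by right].
    by rewrite inE; apply: sumsE (sumsD (ltnW jl) sq); lia.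
  apply: (IHk i' j _ p) => //; try lia.
  rewrite lt0n; apply: contraNneq pT => i'0; rewrite !inE.
  apply/orP; left; apply: sumsE (sumsD (ltnW jl) sp); first by lia.
  by rewrite i'0 a0; lia.
have gj := a_incr jl.
have i'j : i' != j by apply/eqP; lia.
have i'l : (i' < l)%N by lia.
have g2 := two_gaps i'l jl i'j.
have [p ep] : {p : 'I_N | (p : nat)%:Z = (q : nat)%:Z + (a j - a j.+1)}.
  apply: ordW; first by move: h; rewrite ei /=; lia.
  by have := ltn_ord q; lia.
have sp : sums (m - 2) (w - (p : nat)%:Z - a i - a j.+1).
  by apply: sumsE sq => //; rewrite ep; lia.
have [pT|pT] := boolP (p \in ends m w).
  exists q, p, j; split=> //; [by apply/andP; split=> //; lia | | by left].
  by rewrite inE; apply: sumsE (sumsD (ltnW il) sq); lia.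
apply: (IHk i j.+1 _ p) => //; try lia.
rewrite ltn_neqAle jl andbT; apply: contraNneq pT => jl'; rewrite !inE.
apply/orP; right; apply: sumsE (sumsD (ltnW il) sp); first by lia.
by rewrite jl'; lia.
Qed.

Lemma sums1 v : sums 1 v -> exists2 t, (t <= l)%N & v = a t.
Proof. by case/existsP=> t /eqP vt; exists t; [rewrite -ltnS | lia]. Qed.

Lemma sums1_a t : (t <= l)%N -> sums 1 (a t).
Proof.
by move=> tl; apply/existsP; exists (Ordinal (tl : (t < l.+1)%N)); rewrite /= subrr.
Qed.

Lemma ends_inner (m w : int) (q : 'I_N) : q \in P m w -> q \notin ends m w ->
  inner m (w - (q : nat)%:Z).
Proof.
rewrite !inE negb_or => sq /andP[n0 nD]; apply/and3P; split=> //.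
by apply: contraNN nD => s; apply: sumsE s; lia.
Qed.

Lemma inner_pair m w (q : 'I_N) : 1 < m -> q \in P m w -> q \notin ends m w ->
  exists i j, [/\ (0 < i)%N, (i <= j)%N, (j < l)%N &
    sums (m - 2) (w - (q : nat)%:Z - a i - a j)].
Proof.
move=> m1 qP qT; have iq := ends_inner qP qT.
have m0 : 0 < m by lia.
have [i [i0 il ii]] := inner_split m0 iq.
have m10 : 0 < m - 1 by lia.
have [j [j0 jl /and3P[sj _ _]]] := inner_split m10 ii.
have [ij|/ltnW ji] := leqP i j; [exists i, j | exists j, i]; split=> //;
  apply: sumsE sj; lia.
Qed.

(** Let [p] be in [ends 2 w], so that [w - p] is the sum of an end and another
exponent.  Moving the latter to one of its neighbours gives a second point, as
one of the two neighbours keeps it in the window.  If both exponents are ends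
and [w - p = D], one can replace [D] by the exponent before it or [0] by the
one after it, with the same effect.  If [w - p] is [0] or [2 D], only one
neighbour is left, and the position of a point outside [ends 2 w] shows that
there is room for it. *)
Lemma ends_two w (q : 'I_N) : q \in P 2 w -> q \notin ends 2 w ->
  (1 < #|ends 2 w|)%N.
Proof.
move=> qP qT; have [i [j [i0 ij jl sq]]] := inner_pair (isT : (1 : int) < 2) qP qT.
have [q' [p [z [/andP[z0 zl] _ q'P pT _]]]] := spread i0 ij jl qT sq.
rewrite ltnNge; apply/negP => T1.
have only x : 0 <= x -> x < N%:Z -> x <> (p : nat)%:Z ->
    (exists2 t, (t <= l)%N & w - x = a t \/ w - x = D + a t) -> False.
  move=> x0 xN xp [t tl wt]; have [o eo] := ordW x0 xN.
  have oT : o \in ends 2 w.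
    rewrite !inE eo; case: wt => wt; apply/orP; [left | right];
      by apply: sumsE (sums1_a tl); lia.
  have /card_le1_eqP/(_ _ _ oT pT) op := T1.
  by apply: xp; rewrite -eo op.
have pN : (p : nat)%:Z < N%:Z by have := ltn_ord p; lia.
have p0 : 0 <= (p : nat)%:Z by [].
have l0 : (0 < l)%N by lia.
have l'l : (l.-1 < l)%N by lia.
have l'1 : l.-1.+1 = l by lia.
have g0 := a_incr l0; have gl := a_incr l'l; rewrite a0 in g0; rewrite l'1 in gl.
have g0l := two_gaps l0 l'l; rewrite a0 l'1 in g0l.
have {}g0l : a 1%N - 0 + (D - a l.-1) <= N by apply: g0l; apply/eqP; lia.
have step t : (0 < t < l)%N -> (p : nat)%:Z + (a t - a t.-1) < N%:Z \/
    0 <= (p : nat)%:Z + (a t - a t.+1).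
  case/andP=> t0 tl; have t'l : (t.-1 < l)%N by lia.
  have := two_gaps t'l tl; have -> : t.-1.+1 = t by lia.
  have tt : t.-1 != t by apply/eqP; lia.
  by move=> /(_ tt); lia.
have stepL t : (0 < t < l)%N -> a t.-1 < a t < a t.+1.
  case/andP=> t0 tl; rewrite a_incr // andbT.
  have t'l : (t.-1 < l)%N by lia.
  by have := a_incr t'l; rewrite prednK.
have za := a_mono z0 (ltnW zl).
have [y yl ey] : exists2 y, (y <= l)%N & w - a z - (q' : nat)%:Z = a y.
  by apply: sums1; move: q'P; rewrite inE.
have yb := a_bound yl; have zb := a_bound (ltnW zl).
have q'N : (q' : nat)%:Z < N%:Z by have := ltn_ord q'; lia.
have q'0 : 0 <= (q' : nat)%:Z by [].
have zb' : a z <= a l.-1 by apply: a_mono; lia.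
have mid : w - (p : nat)%:Z = D -> False.
  move=> wp; have [h|h] : (p : nat)%:Z + (D - a l.-1) < N%:Z \/
      0 <= (p : nat)%:Z - a 1%N by lia.
    by apply: (only ((p : nat)%:Z + (D - a l.-1))); [lia | lia | lia | exists l.-1; [lia | left; lia]].
  by apply: (only ((p : nat)%:Z - a 1%N)); [lia | lia | lia | exists 1%N; [lia | right; lia]].
have [t tl [wt|wt]] : exists2 t, (t <= l)%N &
    w - (p : nat)%:Z = a t \/ w - (p : nat)%:Z = D + a t.
  move: pT; rewrite !inE => /orP[/sums1[t tl et]|/sums1[t tl et]]; exists t => //.
    by left.
  by right; lia.
- case: (posnP t) => [t0|t0].
    rewrite t0 a0 in wt.
    by apply: (only ((p : nat)%:Z - a 1%N)); [lia | lia | lia | exists 1%N; [lia | left; lia]].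
  case: (ltnP t l) => [tl'|lt]; last first.
    by apply: mid; rewrite wt; congr (a _); lia.
  have ti : (0 < t < l)%N by rewrite t0.
  have := stepL _ ti; case: (step _ ti) => h st.
    by apply: (only ((p : nat)%:Z + (a t - a t.-1))); [lia | lia | lia | exists t.-1; [lia | left; lia]].
  by apply: (only ((p : nat)%:Z + (a t - a t.+1))); [lia | lia | lia | exists t.+1; [lia | left; lia]].
case: (posnP t) => [t0|t0].
  by apply: mid; rewrite wt t0 a0; lia.
case: (ltnP t l) => [tl'|lt]; last first.
  have et : t = l by lia.
  rewrite et in wt.
  by apply: (only ((p : nat)%:Z + (D - a l.-1))); [lia | lia | lia | exists l.-1; [lia | right; lia]].
have ti : (0 < t < l)%N by rewrite t0.
have := stepL _ ti; case: (step _ ti) => h st.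
  by apply: (only ((p : nat)%:Z + (a t - a t.-1))); [lia | lia | lia | exists t.-1; [lia | right; lia]].
by apply: (only ((p : nat)%:Z + (a t - a t.+1))); [lia | lia | lia | exists t.+1; [lia | right; lia]].
Qed.

(** If [ends] has not grown when the exponent [z] given by [spread] is added,
then by [ends_flat] it is stable under going up by the gap below [z] and down
by the gap above [z], hence under the opposite moves by [rotation].  The last
step of [spread] entered it by one of the direct moves, so it started inside:
a contradiction. *)
Lemma growth (k : nat) w (q : 'I_N) : (1 < k)%N ->
  q \in P k w -> q \notin ends k w -> (k <= #|ends k w|)%N.
Proof.
elim: k w q => // k IHk w q; rewrite ltnS leq_eqVlt => /orP[/eqP<-|k1 qP qT].
  exact: ends_two.
rewrite leqNgt; apply/negP; rewrite ltnS => le_k.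
have k1' : (1 : int) < k.+1 by lia.
have [i [j [i0 ij jl sq]]] := inner_pair k1' qP qT.
have [q' [p [z [/andP[z0 zl] q'T q'P pT pq]]]] := spread i0 ij jl qT sq.
have ek : (k : int) = k.+1%:Z - 1 by lia.
have flat : ends (k.+1%:Z - 1) (w - a z) = ends k.+1 w.
  apply/eqP; rewrite eqEcard ends_mono ?(ltnW zl) // (leq_trans le_k) //.
  rewrite -ek; apply: (IHk _ q') => //; first by rewrite ek.
  apply: contraNN q'T; rewrite ek; apply: (subsetP (ends_mono _ _ _)); exact: ltnW.
have z'l : (z.-1 < l)%N by lia.
have gz := a_incr zl; have gz' := a_incr z'l.
have z1 : z.-1.+1 = z by lia.
have zz' : z.-1 != z by apply/eqP; lia.
have g2 := two_gaps z'l zl zz'; rewrite z1 in g2 gz'.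
have cU := ends_flat (ltnW zl) zl flat.
have cD := ends_flat (ltnW zl) (ltnW z'l) flat.
have [|||||rU rD] := @rotation (ends k.+1 w) (a z.+1 - a z) (a z - a z.-1).
- lia.
- lia.
- lia.
- by rewrite opprB.
- exact: cD.
move/negP: q'T; apply; case: pq => pq.
  by apply: (rU _ _ pT); lia.
by apply: (rD _ _ pT); lia.
Qed.

(** * Periodic sets in the window *)

Lemma shift_mult (T : {set 'I_N}) (d : nat) (k : nat) (p q : 'I_N) :
  shift_closed T d%:Z -> shift_closed T (- d%:Z) -> p \in T ->
  (q = p + k * d :> nat)%N \/ (p = q + k * d :> nat)%N -> q \in T.
Proof.
move=> Td Td'; elim: k p => [|k IHk] p Tp pq.
  by suff -> : q = p by []; apply: val_inj; case: pq => /= ->; rewrite mul0n addn0.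
rewrite mulSn in pq.
have [r [Tr rq]] : exists r : 'I_N, r \in T /\
    ((q = r + k * d :> nat)%N \/ (r = q + k * d :> nat)%N).
  case: pq => pq.
    have rN : (p + d < N)%N by have := ltn_ord q; lia.
    exists (Ordinal rN); split; last by left => /=; lia.
    by apply: Td Tp _ => /=; lia.
  have rN : (p - d < N)%N by have := ltn_ord p; lia.
  exists (Ordinal rN); split; last by right => /=; lia.
  by apply: Td' Tp _ => /=; lia.
exact: IHk Tr rq.
Qed.

Definition shift_closedb (T : {set 'I_N}) (d : int) :=
  [forall p : 'I_N, forall q : 'I_N,
    (p \in T) ==> ((q : nat)%:Z == (p : nat)%:Z + d) ==> (q \in T)].

Lemma shift_closedP T d : reflect (shift_closed T d) (shift_closedb T d).
Proof.
apply: (iffP forallP) => [H p q Tp /eqP pq|H p].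
  by move/forallP: (H p) => /(_ q); rewrite Tp pq.
by apply/forallP=> q; apply/implyP=> Tp; apply/implyP=> /eqP; apply: H.
Qed.

(** Stability under translation by [x] modulo [d] on [T]: the translate of a
point need not lie in the window, but some point of its class does. *)
Definition class_shift (d : nat) (T : {set 'I_N}) (x : int) :=
  forall p : 'I_N, p \in T ->
    exists2 q : 'I_N, q \in T & exists k : int, (q : nat)%:Z = (p : nat)%:Z + x + k * d%:Z.

Lemma class_shift_iter d T x (n : nat) :
  class_shift d T x -> class_shift d T (n%:Z * x).
Proof.
move=> cx; elim: n => [|n IHn] p Tp; first by exists p => //; exists 0; lia.
have [q Tq [k qk]] := IHn p Tp; have [r Tr [k' rk]] := cx q Tq.
by exists r => //; exists (k + k'); rewrite rk qk; lia.
Qed.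

(** The least period [d] of a periodic set.  A translation that preserves the
set of classes met by [T] permutes it, since this set is finite; its remainder
modulo [d] is then a smaller period unless it is [0]. *)
Lemma min_period T g : (0 < g)%N -> shift_closed T g%:Z -> shift_closed T (- g%:Z) ->
  exists d : nat, [/\ (0 < d <= g)%N,
    forall (p q : 'I_N) (k : int), p \in T -> (q : nat)%:Z = (p : nat)%:Z + k * d%:Z -> q \in T,
    (forall g', (0 < g')%N -> shift_closed T g'%:Z -> shift_closed T (- g'%:Z) -> (d <= g')%N) &
    forall x, class_shift d T x -> exists k, x = k * d%:Z].
Proof.
move=> g0 Tg Tg'.
pose A d := [&& (0 < d)%N, shift_closedb T d%:Z & shift_closedb T (- d%:Z)].
have exA : exists d, A d.
  by exists g; rewrite /A g0 /=; apply/andP; split; apply/shift_closedP.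
case: (ex_minnP exA) => d /and3P[d0 /shift_closedP Td /shift_closedP Td'] dmin.
have per (p q : 'I_N) (k : int) :
    p \in T -> (q : nat)%:Z = (p : nat)%:Z + k * d%:Z -> q \in T.
  move=> Tp; case: k => k pq; first by apply: (shift_mult (k := k) Td Td' Tp); lia.
  by apply: (shift_mult (k := k.+1) Td Td' Tp); right; move: pq; rewrite NegzE; lia.
have least g' : (0 < g')%N -> shift_closed T g'%:Z -> shift_closed T (- g'%:Z) -> (d <= g')%N.
  move=> g'0 Tg1 Tg2; apply: dmin; rewrite /A g'0 /=.
  by apply/andP; split; apply/shift_closedP.
exists d; split=> //.
  by rewrite d0 least.
move=> x cx; have dZ : d%:Z != 0 by lia.
have xE := divz_eq x d%:Z; have r0 := modz_ge0 x dZ.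
have rd : (x %% d)%Z < d by apply: ltz_pmod; lia.
have [r0'|/eqP r0'] := eqVneq (x %% d)%Z 0; first by exists (x %/ d)%Z; lia.
have [r er] : exists r : nat, (x %% d)%Z = r by exists `|(x %% d)%Z|%N; lia.
have: (d <= r)%N; last by lia.
apply: least; first by lia.
  move=> p q Tp pq; have [p' Tp' [k p'k]] := cx p Tp.
  by apply: (per p' q (- k - (x %/ d)%Z) Tp'); lia.
(* Translation by - x is translation by (d - 1) * x modulo d. *)
move=> p q Tp pq; have [p' Tp' [k p'k]] := class_shift_iter d.-1 cx Tp.
apply: (per p' q (- k - x + (x %/ d)%Z) Tp').
rewrite p'k pq; have -> : (d.-1)%:Z = d%:Z - 1 by lia.
by rewrite er in xE; lia.
Qed.

(** Consecutive candidates differ by a gap, which is less than the length of the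
window, so one of them falls into the window.  The same holds for
[reach_down]. *)
Lemma reach_up (b : int) j : (j <= l)%N -> b < N%:Z -> 0 <= b + (D - a j) ->
  exists i, [/\ (j <= i)%N, (i <= l)%N & 0 <= b + (D - a i) < N%:Z].
Proof.
elim: {j}(l - j)%N {-2}j (erefl (l - j)%N) => [|k IHk] j ej jl bN bj.
  have ejl : j = l by lia.
  by exists j; split=> //; move: bj; rewrite ejl; lia.
case: (ltrP (b + (D - a j)) N%:Z) => h; first by exists j; split=> //; lia.
have jl' : (j < l)%N by lia.
have gj := gap_le jl'.
have [i [ji il hi]] : exists i, [/\ (j.+1 <= i)%N, (i <= l)%N & 0 <= b + (D - a i) < N%:Z].
  by apply: IHk => //; lia.
by exists i; split=> //; lia.
Qed.

Lemma reach_down (b : int) i : (i <= l)%N -> 0 <= b -> b - a i < N%:Z ->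
  exists j, (j <= i)%N /\ 0 <= b - a j < N%:Z.
Proof.
move=> il b0; elim: i il => [|i IHi] il bi; first by exists 0%N; rewrite a0 in bi *; lia.
case: (lerP 0 (b - a i.+1)) => h; first by exists i.+1; lia.
have gi := gap_le il.
by have [||j [ji hj]] := IHi; [lia | lia | exists j; lia].
Qed.

(** A set [T] that is unchanged by adding [0] and by adding [D] is stable under
the moves [- a i] and [D - a i], hence periodic by [rotation] applied to the
first and the last gap.  Its least period [d] divides these two gaps.  The set
[T0] stands for the same window with both ends removed; a point of [T0] may be
moved by [D - a i - a j], and at most one point of [T] is missing from [T0].

Suppose that [d] does not divide every exponent.  Let [i1] be the first with
[d] not dividing [a i1], and [j1] the last with [d] not dividing [D - a j1].
If every class of [T] modulo [d] contained a point of [T0] that stays in the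
window after the move by [D - a i1 - a j] for some [j > j1], then [T] would be
stable under translation by [- a i1] modulo [d], and [d] would divide [a i1]:
this is [nX].  Symmetrically, moving by [D - a i - a j1] for some [i < i1] is
excluded by [nY].  But one of the two is always possible.  Start from the
highest point of each class in the first case and from the lowest in the
second, and replace the possible missing point by its neighbour at distance
[d].  There is room for this when the multiples of [d] preceding them,
[a (i1 - 1)] and [D - a (j1 + 1)], are different.  When they are equal, no replacement is needed:
as [2 d <= N], the missing point is not both a highest and a lowest one. *)
Lemma core (T T0 : {set 'I_N}) :
    (forall i, (i <= l)%N -> shift_closed T (- a i)) ->
    (forall i, (i <= l)%N -> shift_closed T (D - a i)) ->
    (forall i j (p q : 'I_N), (i <= l)%N -> (j <= l)%N -> p \in T0 ->
       (q : nat)%:Z = (p : nat)%:Z + (D - a i - a j) -> q \in T) ->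
    (forall p q : 'I_N, p \in T -> q \in T -> p \notin T0 -> q \notin T0 -> p = q) ->
  exists2 d : nat, forall i, (i <= l)%N -> exists k, a i = k * d%:Z &
    forall (p q : 'I_N) (k : int), p \in T ->
      (q : nat)%:Z = (p : nat)%:Z + k * d%:Z -> q \in T.
Proof.
move=> down up both one.
have l0 : (0 < l)%N by lia.
have l'l : (l.-1 < l)%N by lia.
have l'1 : l.-1.+1 = l by lia.
have g0 := a_incr l0; have gl := a_incr l'l; rewrite a0 in g0; rewrite l'1 in gl.
have g0l : a 1%N + (D - a l.-1) <= N.
  have := two_gaps l0 l'l; rewrite a0 l'1 => H; rewrite subr0 in H.
  by apply: H; apply/eqP; lia.
have [T1 Tl'] : shift_closed T (a 1%N) /\ shift_closed T (- (D - a l.-1)).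
  by apply: rotation; [lia | lia | lia | exact: down | apply: up; lia].
have T1' := down 1%N l0; have Tl := up l.-1 (ltnW l'l).
have ea : a 1%N = `|a 1%N|%N by lia.
have eb : D - a l.-1 = `|D - a l.-1|%N by lia.
rewrite ea in T1 T1'; rewrite eb in Tl Tl'.
have [|d [/andP[d0 d1] per least clsd]] := min_period _ T1 T1'; first by lia.
have dl : (d <= `|D - a l.-1|)%N by apply: least => //; lia.
exists d => //.
have top p : p \in T -> exists q : 'I_N, [/\ q \in T, N%:Z - d%:Z <= (q : nat)%:Z &
    exists k, (q : nat)%:Z = (p : nat)%:Z + k * d%:Z].
  move=> Tp; pose k := ((N - 1 - p) %/ d)%N.
  have := divn_eq (N - 1 - p) d; have := ltn_pmod (N - 1 - p) d0; rewrite -/k => h1 h2.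
  have qN : (p + k * d < N)%N by have := ltn_ord p; lia.
  have eq : (Ordinal qN : nat)%:Z = (p : nat)%:Z + k%:Z * d%:Z by rewrite /=; lia.
  exists (Ordinal qN); split; [exact: per Tp eq | rewrite /=; have := ltn_ord p; lia | by exists k%:Z].
have bot p : p \in T -> exists q : 'I_N, [/\ q \in T, (q : nat)%:Z < d%:Z &
    exists k, (q : nat)%:Z = (p : nat)%:Z + k * d%:Z].
  move=> Tp; pose k := (p %/ d)%N.
  have := divn_eq p d; have := ltn_pmod p d0; rewrite -/k => h1 h2.
  have qN : (p - k * d < N)%N by have := ltn_ord p; lia.
  have eq : (Ordinal qN : nat)%:Z = (p : nat)%:Z + (- k%:Z) * d%:Z by rewrite /=; lia.
  by exists (Ordinal qN); split; [exact: per Tp eq | rewrite /=; lia | exists (- k%:Z)].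
have [k1 ek1] : exists k, - a 1%N = k * d%:Z.
  apply: clsd => p Tp; have [q [Tq qN [k qk]]] := top p Tp.
  have [r er] : {r : 'I_N | (r : nat)%:Z = (q : nat)%:Z - a 1%N}.
    by apply: ordW; [lia | have := ltn_ord q; lia].
  exists r; last by exists k; lia.
  by apply: (down 1%N l0 q r Tq); lia.
have [kl ekl] : exists k, D - a l.-1 = k * d%:Z.
  apply: clsd => p Tp; have [q [Tq qN [k qk]]] := bot p Tp.
  have [r er] : {r : 'I_N | (r : nat)%:Z = (q : nat)%:Z + (D - a l.-1)}.
    by apply: ordW; lia.
  exists r; last by exists k; lia.
  by apply: (up l.-1 (ltnW l'l) q r Tq); lia.
have dd : 2 * d%:Z <= N%:Z by lia.
suff dvd_a i : (i <= l)%N -> (d%:Z %| a i)%Z by move=> i /dvd_a/dvdzP.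
move=> il; apply: contraT => ndi.
pose B i := (i <= l)%N && ~~ (d%:Z %| a i)%Z.
pose C j := (j <= l)%N && ~~ (d%:Z %| D - a j)%Z.
have exB : exists i, B i by exists i; rewrite /B il.
have exC : exists j, C j.
  have [/existsP[j nj]|] := boolP [exists j : 'I_l.+1, ~~ (d%:Z %| D - a j)%Z].
    by exists j; rewrite /C nj -ltnS ltn_ord.
  rewrite negb_exists => /forallP dvdC.
  have dD j : (j <= l)%N -> (d%:Z %| D - a j)%Z.
    by move=> jl; have := dvdC (Ordinal (jl : (j < l.+1)%N)); rewrite negbK.
  case/negP: ndi; rewrite -[a i](subKr D) rpredB ?dD //.
  by have := dD 0%N isT; rewrite a0 subr0.
have Cl j : C j -> (j <= l)%N by case/andP.
case: (ex_minnP exB) => i1 /andP[i1l ndi1] mini.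
case: (ex_maxnP exC Cl) => j1 /andP[j1l ndj1] maxj.
have dvd_low i' : (i' < i1)%N -> exists k, a i' = k * d%:Z.
  move=> i'i; apply/dvdzP; apply: contraT => nd.
  by have := mini i'; rewrite /B nd andbT (leq_trans (ltnW i'i) i1l) leqNgt i'i => /(_ isT).
have dvd_high j' : (j1 < j')%N -> (j' <= l)%N -> exists k, D - a j' = k * d%:Z.
  move=> jj' j'l; apply/dvdzP; apply: contraT => nd.
  by have := maxj j'; rewrite /C nd andbT j'l leqNgt jj' => /(_ isT).
have i1_gt1 : (1 < i1)%N.
  case: i1 ndi1 {i1l mini dvd_low} => [|[|//]]; first by rewrite a0 dvdz0.
  by move/negP; case; rewrite -rpredN; apply/dvdzP; exists k1.
have j1_ltl : (j1 < l.-1)%N.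
  rewrite ltn_neqAle; apply/andP; split.
    by apply: contraNneq ndj1 => ->; apply/dvdzP; exists kl.
  rewrite -ltnS l'1 ltn_neqAle j1l andbT.
  by apply: contraNneq ndj1 => ->; rewrite subrr dvdz0.
have i1l' : (i1.-1 < l)%N by lia.
have j1l' : (j1 < l)%N by lia.
have i1S : i1.-1.+1 = i1 by lia.
have G1 : a i1 - a i1.-1 + d%:Z <= N%:Z.
  have := two_gaps i1l' l0; rewrite i1S a0 => H.
  have : i1.-1 != 0%N by lia.
  by move/H; lia.
have G2 : a j1.+1 - a j1 + d%:Z <= N%:Z.
  have := two_gaps j1l' l'l; rewrite l'1 => H.
  have : j1 != l.-1 by lia.
  by move/H; lia.
have [ka eka] : exists k, a i1.-1 = k * d%:Z by apply: dvd_low; lia.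
have [kb ekb] : exists k, D - a j1.+1 = k * d%:Z by apply: dvd_high; lia.
have nX : ~ forall p : 'I_N, p \in T -> exists p0 : 'I_N, [/\ p0 \in T0,
    exists k, (p0 : nat)%:Z = (p : nat)%:Z + k * d%:Z &
    0 <= (p0 : nat)%:Z - a i1 + (D - a j1.+1)].
  move=> H; case/negP: ndi1; rewrite -rpredN; apply/dvdzP; apply: clsd => p Tp.
  have [p0 [T0p0 [k ek] pos]] := H p Tp.
  have bN : (p0 : nat)%:Z - a i1 < N%:Z.
    by have := ltn_ord p0; have := a_bound i1l; lia.
  have [j' [jj' j'l rW]] := reach_up j1l' bN pos.
  have [k' ek'] := dvd_high j' jj' j'l.
  have [r er] : {r : 'I_N | (r : nat)%:Z = (p0 : nat)%:Z - a i1 + (D - a j')}.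
    by apply: ordW; lia.
  by exists r; [apply: (both i1 j' p0) => //; lia | exists (k + k'); lia].
have nY : ~ forall p : 'I_N, p \in T -> exists p0 : 'I_N, [/\ p0 \in T0,
    exists k, (p0 : nat)%:Z = (p : nat)%:Z + k * d%:Z &
    (p0 : nat)%:Z + (D - a j1) - a i1.-1 < N%:Z].
  move=> H; case/negP: ndj1; apply/dvdzP; apply: clsd => p Tp.
  have [p0 [T0p0 [k ek] pos]] := H p Tp.
  have b0 : 0 <= (p0 : nat)%:Z + (D - a j1) by have := a_bound j1l; lia.
  have [i' [ii' rW]] := reach_down (ltnW i1l') b0 pos.
  have [k' ek'] := dvd_low i' (leq_ltn_trans ii' (ltac:(lia) : (i1.-1 < i1)%N)).
  have [r er] : {r : 'I_N | (r : nat)%:Z = (p0 : nat)%:Z + (D - a j1) - a i'}.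
    by apply: ordW; lia.
  by exists r; [apply: (both j1 i' p0) => //; lia | exists (k - k'); lia].
have dstep (ka' kb' : int) : ka' < kb' -> ka' * d%:Z + d%:Z <= kb' * d%:Z by nia.
have [kab|kba|kk] := ltrgtP ka kb.
- have dk := dstep _ _ kab.
  case: nX => p Tp; have [q [Tq qN [k qk]]] := top p Tp.
  have [T0q|nT0q] := boolP (q \in T0).
    by exists q; split=> //; [exists k | lia].
  have [r er] : {r : 'I_N | (r : nat)%:Z = (q : nat)%:Z - d%:Z}.
    by apply: ordW; [lia | have := ltn_ord q; lia].
  have Tr : r \in T by apply: (per q r (-1)) => //; lia.
  exists r; split; [|by exists (k - 1); lia|lia].
  by apply: contraT => nT0r; have qr := one q r Tq Tr nT0q nT0r; move: er; rewrite qr; lia.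
- have dk := dstep _ _ kba.
  case: nY => p Tp; have [q [Tq qN [k qk]]] := bot p Tp.
  have [T0q|nT0q] := boolP (q \in T0).
    by exists q; split=> //; [exists k | lia].
  have [r er] : {r : 'I_N | (r : nat)%:Z = (q : nat)%:Z + d%:Z}.
    by apply: ordW; lia.
  have Tr : r \in T by apply: (per q r 1) => //; lia.
  exists r; split; [|by exists (k + 1); lia|lia].
  by apply: contraT => nT0r; have qr := one q r Tq Tr nT0q nT0r; move: er; rewrite qr; lia.
have [/existsP[s /and3P[Ts nT0s sN]]|/existsPn noS] :=
  boolP [exists s : 'I_N, [&& s \in T, s \notin T0 & N%:Z - d%:Z <= (s : nat)%:Z]].
  case: nY => p Tp; have [q [Tq qN [k qk]]] := bot p Tp.
  exists q; split=> //; [|by exists k|lia].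
  by apply: contraT => nT0q; have qs := one q s Tq Ts nT0q nT0s; move: sN; rewrite -qs; lia.
case: nX => p Tp; have [q [Tq qN [k qk]]] := top p Tp.
exists q; split=> //; [|by exists k|lia].
by apply: contraT => nT0q; have := noS q; rewrite Tq nT0q qN.
Qed.

(** * Holes and pauses *)

(** Reflecting the window exchanges the two ends, so each argument is made once,
for an ordered pair of them. *)
Definition end_pair (x y : int) := (x = 0 /\ y = D) \/ (x = D /\ y = 0).

Lemma end_pairC x y : end_pair x y -> end_pair y x.
Proof. by case=> [[-> ->]|[-> ->]]; [right | left]. Qed.

(** Hypotheses on window sets only slow [lia] down. *)
Ltac arith :=
  repeat match goal with H : context [P _ _] |- _ => clear H end; lia.

Lemma P_end x y (m w m' w' : int) : end_pair x y -> m' = m + 1 -> w' = w + x ->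
  P m w \subset P m' w'.
Proof.
case=> [[-> _]|[-> _]] em ew; first by apply: (P_sub (leq0n l)) => //; rewrite a0.
exact: (P_sub (leqnn l)).
Qed.

Lemma P_ends x y (t : nat) (m w m' w' : int) : end_pair x y -> m' = m + t%:Z ->
  w' = w + t%:Z * x -> P m w \subset P m' w'.
Proof.
move=> xy -> ->; elim: t => [|t IHt]; first by rewrite addr0 mul0r addr0.
by apply: subset_trans IHt _; apply: (P_end xy); lia.
Qed.

Lemma endsE x y (m w : int) : end_pair x y -> ends m w = P (m - 1) (w - x) :|: P (m - 1) (w - y).
Proof. by rewrite /ends => -[[-> ->]|[-> ->]]; rewrite subr0 // setUC. Qed.

Definition holes (m w : int) : {set 'I_N} :=
  (P (m + 1) w :&: P (m + 1) (w + D)) :\: P m w.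

Lemma in_holes x y (m w : int) p : end_pair x y ->
  (p \in holes m w) = [&& p \in P (m + 1) (w + x), p \in P (m + 1) (w + y) & p \notin P m w].
Proof.
by move=> xy; rewrite in_setD in_setI; case: xy => [[-> ->]|[-> ->]]; rewrite addr0;
  case: (p \in P m w); case: (p \in P (m + 1) w); rewrite /= ?andbT ?andbF.
Qed.

Definition at_least (m : int) (X : {set 'I_N}) := m <= #|X|%:Z.

(** Nonemptiness of [holes] in large degree would contradict the bound, because
the window has only [N] points and one of them is a hole. *)
Definition hole_bound (m w : int) := forall x y, end_pair x y -> holes m w != set0 ->
  at_least (m + 1) (P (m + 1) (w + y) :\: holes m w).

(** A window set that pauses along [x] and then grows is large, as if it had
gained a point in every degree. *)
Definition flat_bound (m w : int) := forall x y, end_pair x y ->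
  P m w = P (m - 1) (w - x) -> P m w != set0 -> P (m + 1) (w + x) != P m w ->
  at_least (m + 1) (P m w).

(** [R] is carried along because it accounts for the first points, given by
[growth].  At each step some point [p] is new in [P], unless the step is flat.
If [p] is not in [R], the union grows.  If [p] is in [R], then [p] is reached
with either end and hence is a hole of the previous degree, so that the bound
on holes gives the points that are needed, and [p] is one more. *)
Lemma ladder x y (K : nat) (d v : int) (R : {set 'I_N}) : end_pair x y ->
    R \subset P (d + 1) (v + y) -> at_least (d + 1) (P d v :|: R) ->
    (forall t : nat, (t < K)%N -> hole_bound (d + t%:Z) (v + t%:Z * x)) ->
    (forall t : nat, (t < K)%N ->
       P (d + t%:Z) (v + t%:Z * x) = P (d + t%:Z + 1) (v + t%:Z * x + x) ->
       at_least (d + t%:Z + 2) (P (d + t%:Z) (v + t%:Z * x))) ->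
  forall t : nat, (t <= K)%N -> at_least (d + t%:Z + 1) (P (d + t%:Z) (v + t%:Z * x) :|: R).
Proof.
move=> xy RP base hb flat; elim=> [|t IHt] tK; first by rewrite addr0 mul0r addr0.
have {}IHt := IHt (ltnW tK).
have eS : P (d + t.+1%:Z) (v + t.+1%:Z * x) = P (d + t%:Z + 1) (v + t%:Z * x + x).
  by congr (P _ _); arith.
rewrite eS; set X := P (d + t%:Z) _ in IHt *; set X' := P (d + t%:Z + 1) _.
have XX' : X \subset X' by apply: (P_end xy).
have sub : X \subset X' :|: R by apply: subset_trans XX' (subsetUl _ _).
have [eX|] := eqVneq X X'.
  by have := flat t tK eX; have := subset_leq_card sub; rewrite /at_least -/X; lia.
rewrite eqEsubset XX' /= => /subsetPn[p pX' pX].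
have [pR|pR] := boolP (p \in R); last first.
  suff : (#|X :|: R| < #|X' :|: R|)%N by move: IHt; rewrite /at_least; lia.
  apply: proper_card; rewrite properE setSU //=; apply/subsetPn; exists p.
    by rewrite inE pX'.
  by rewrite inE negb_or pX.
have ph : p \in holes (d + t%:Z) (v + t%:Z * x).
  rewrite (in_holes _ _ _ xy) pX' pX andbT /=.
  apply: (subsetP _ p pR); apply: subset_trans RP _.
  by apply: (P_ends (t := t) xy); arith.
have h0 : holes (d + t%:Z) (v + t%:Z * x) != set0 by apply/set0Pn; exists p.
have := hb t tK y x (end_pairC xy) h0; rewrite -/X'.
have : (#|X' :\: holes (d + t%:Z) (v + t%:Z * x)| < #|X'|)%N.
  apply: proper_card; rewrite properE subsetDl; apply/subsetPn; exists p => //.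
  by rewrite inE ph.
have := subset_leq_card (subsetUl X' R); move: IHt; rewrite /at_least; lia.
Qed.

(** Just before the first change the set is still the same, while the degree is
larger than at the start of the pause; so [flat_bound] there gives one point
more than at the start. *)
Lemma flat_jump x y (m w : int) (J : nat) : end_pair x y -> P m w != set0 ->
    P m w = P (m + 1) (w + x) -> P (m + J%:Z) (w + J%:Z * x) != P m w ->
    (forall j : nat, (j < J)%N -> flat_bound (m + j%:Z) (w + j%:Z * x)) ->
  at_least (m + 2) (P m w).
Proof.
move=> xy n0 flat jump fb.
have ex : exists j : nat, P (m + j%:Z) (w + j%:Z * x) != P m w by exists J.
case: (ex_minnP ex) => j nj minj.
have jJ : (j <= J)%N by apply: minj.
have eqj i : (i < j)%N -> P (m + i%:Z) (w + i%:Z * x) = P m w.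
  by move=> ij; apply/eqP; apply: contraTT ij => /minj; rewrite -leqNgt.
have j2 : (1 < j)%N.
  case: j nj {minj jJ eqj} => [|[|//]]; first by rewrite addr0 mul0r addr0 eqxx.
  by rewrite mul1r -flat eqxx.
have [i ei] : exists i, j = i.+2 by exists j.-2; arith.
have e1 := eqj i.+1 (ltac:(lia) : (i.+1 < j)%N).
have e2 := eqj i (ltac:(lia) : (i < j)%N).
have := fb i.+1 (ltac:(lia) : (i.+1 < J)%N) x y xy; rewrite e1 => H.
suff : at_least (m + i.+1%:Z + 1) (P m w) by rewrite /at_least; arith.
apply: H => //; first by rewrite -e2; congr (P _ _); arith.
by apply: contraNneq nj => <-; apply/eqP; rewrite ei; congr (P _ _); arith.
Qed.

Lemma sums_dvd (d : nat) m v : (forall i, (i <= l)%N -> exists k, a i = k * d%:Z) ->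
  sums m v -> exists k, v = k * d%:Z.
Proof.
move=> da; case: m => // k; elim: k v => [|k IHk] v /=.
  by move=> /eqP ->; exists 0; rewrite mul0r.
case/existsP=> i /IHk[c ec]; have [c' ec'] := da i (ltn_ord i).
by exists (c + c'); arith.
Qed.

Lemma at_least_le (m m' : int) X : m' <= m -> at_least m X -> at_least m' X.
Proof. exact: le_trans. Qed.

(** With both ends removed, the missing points of [P m w] are holes of degree
[m - 2].  If there are two of them, they add up with the [m - 1] other points
granted by the bound on holes.  Otherwise [core] applies: the set is periodic
modulo a common divisor [d] of the exponents, and all points reached from it by
adding exponents are in the same class modulo [d], so the point [q] cannot be
new. *)
Lemma flat_both x y (m w : int) (q : 'I_N) : end_pair x y ->
    hole_bound (m - 2) (w - D) -> P m w != set0 ->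
    P (m - 1) (w - x) = P m w -> P (m - 1) (w - y) = P m w ->
    q \in P (m + 1) (w + x) -> q \notin P m w ->
  at_least (m + 1) (P m w).
Proof.
move=> xy hb /set0Pn[p pT] ex ey qU qT.
pose T0 := P (m - 2) (w - D).
have xyD : x + y = D by case: xy => [[-> ->]|[-> ->]]; rewrite ?add0r ?addr0.
have hE : holes (m - 2) (w - D) = P m w :\: T0.
  apply/setP=> s; rewrite (in_holes _ _ _ xy) in_setD andbC.
  have -> : m - 2 + 1 = m - 1 by arith.
  have -> : w - D + x = w - y by arith.
  have -> : w - D + y = w - x by arith.
  by rewrite ex ey -andbA andbC -andbA andbb.
have [/card_le1_eqP le1|gt1] := leqP #|P m w :\: T0| 1; last first.
  have h0 : holes (m - 2) (w - D) != set0 by rewrite hE -card_gt0 ltnW.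
  have := hb _ _ xy h0; rewrite hE.
  have -> : m - 2 + 1 = m - 1 by arith.
  have -> : w - D + y = w - x by arith.
  rewrite ex /at_least; have := cardsID (P m w :\: T0) (P m w).
  have -> : P m w :&: (P m w :\: T0) = P m w :\: T0.
    by apply/setIidPr; apply: subsetDl.
  lia.
have T0T : T0 \subset P m w by rewrite -ex; apply: (P_end (end_pairC xy)); arith.
have shx i : (i <= l)%N -> shift_closed (P m w) (x - a i).
  by move=> il r s; rewrite -{1}ex => rT; apply: P_shift il rT.
have shy i : (i <= l)%N -> shift_closed (P m w) (y - a i).
  by move=> il r s; rewrite -{1}ey => rT; apply: P_shift il rT.
have [||||d da per] := @core (P m w) T0.
- move=> i il r s rT sr; case: xy => [[ex0 _]|[_ ey0]].
    by apply: (shx i il r s rT); arith.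
  by apply: (shy i il r s rT); arith.
- move=> i il r s rT sr; case: xy => [[_ eyD]|[exD _]].
    by apply: (shy i il r s rT); arith.
  by apply: (shx i il r s rT); arith.
- move=> i j r s il jl; rewrite !inE => sr es.
  by apply: sumsE (sumsD jl (sumsD il sr)); arith.
- by move=> r s rT sT nr ns; apply: le1; rewrite in_setD ?nr ?ns.
case/negP: qT.
have [k1 ek1] : exists k, w - (p : nat)%:Z = k * d%:Z.
  by apply: (sums_dvd (m := m) da); move: pT; rewrite inE.
have [k2 ek2] : exists k, w + x - (q : nat)%:Z = k * d%:Z.
  by apply: (sums_dvd (m := m + 1) da); move: qU; rewrite inE.
have [k3 ek3] : exists k, x = k * d%:Z.
  case: xy => [[-> _]|[-> _]]; first by exists 0; rewrite mul0r.
  exact: da.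
by apply: (per p q (k3 + k1 - k2) pT); arith.
Qed.

Lemma growth_end x y (m w : int) (q : 'I_N) : end_pair x y -> 1 < m ->
  q \in P m w -> q \notin ends m w ->
  at_least m (P (m - 1) (w - x) :|: P (m - 1) (w - y)).
Proof.
move=> xy; rewrite -(endsE _ _ xy); case: m => // k k1 qP qT.
by have := growth (k := k) k1 qP qT; rewrite /at_least; lia.
Qed.

(** Among the points gained when [x] is added, [q] is one that survives the
removal of the largest number [v] of copies of [y].  After this removal it uses
neither end: not [y] by maximality, and not [x] because [q] would then be in
[P m w] already.  So [growth] gives the first points, and the
[v] copies of [y] are added again along the ladder.  Flat steps on the way are
followed by a change, except when the set has already reached [P m w]; then
[P m w] is unchanged by both ends. *)
Lemma flat_step (m w : int) :
    (forall m' w' : int, m' < m -> hole_bound m' w' /\ flat_bound m' w') ->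
  flat_bound m w.
Proof.
move=> IH x y xy eT n0 jump; have yx := end_pairC xy.
have m0 : 0 <= m by case/set0Pn: n0 => p; rewrite inE => /sums_ge0.
have subU : P m w \subset P (m + 1) (w + x) by apply: (P_end xy).
pose U := P (m + 1) (w + x) :\: P m w.
pose A v := [exists q in U, q \in P (m + 1 - v%:Z) (w + x - v%:Z * y)].
have exA : exists v, A v.
  have /subsetPn[q qU qT] : ~~ (P (m + 1) (w + x) \subset P m w).
    by apply: contraNN jump => ?; rewrite eqEsubset subU andbT.
  by exists 0%N; apply/existsP; exists q; rewrite in_setD qU qT /= mul0r !subr0.
have boundA v : A v -> (v <= `|(m + 1)%R|)%N.
  by case/existsP=> q /andP[_]; rewrite inE => /sums_ge0; arith.
case: (ex_maxnP exA boundA) => v /existsP[q /andP[]].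
rewrite in_setD => /andP[qT qU] qv maxv.
pose d := m - v%:Z; pose w0 := w - v%:Z * y.
pose R := P d (w + x - v.+1%:Z * y).
have subT (t : nat) : (t <= v)%N -> P (d + t%:Z) (w0 + t%:Z * y) \subset P m w.
  move=> tv; apply: (P_ends (t := v - t) yx); first by rewrite /d; arith.
  have -> : (v - t)%N%:Z = v%:Z - t%:Z by arith.
  by rewrite /w0; arith.
have qends : q \notin ends (d + 1) (w0 + x).
  rewrite (endsE _ _ xy) in_setU negb_or; apply/andP; split.
    apply: contraNN qT => qP; apply: (subsetP (subT 0%N isT)).
    by move: qP; congr (_ \in P _ _); arith.
  apply/negP => qP; have /maxv : A v.+1; last by rewrite ltnn.
  apply/existsP; exists q; rewrite in_setD qU qT /=.
  by move: qP; congr (_ \in P _ _); rewrite /d /w0; arith.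
have qd : q \in P (d + 1) (w0 + x).
  by move: qv; congr (_ \in P _ _); rewrite /d /w0; arith.
have q0 : 0 <= (q : nat)%:Z by [].
have qN : (q : nat)%:Z < N%:Z by have := ltn_ord q; arith.
(* The bounds on the inner sum that q represents and on a sum represented in
   P m w together put w0 in the range covered by P_neq0. *)
have [d_gt0 X0] : 0 < d /\ P d w0 != set0.
  have /inner_bound qb := ends_inner qd qends.
  case/set0Pn: n0 => p; rewrite eT inE => /sums_bound pb.
  have p0 : 0 <= (p : nat)%:Z by [].
  have pN : (p : nat)%:Z < N%:Z by have := ltn_ord p; arith.
  move: qb pb; rewrite /w0 /d; case: xy => [[-> ->]|[-> ->]] qb pb.
    have D0 := N_le.
    have d1 : 0 < m - v%:Z by nia.
    by split=> //; apply: P_neq0; arith.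
  have D0 := N_le.
  have d1 : 0 < m - v%:Z by nia.
  by split=> //; apply: P_neq0; arith.
have eR : P d (w0 + x - y) = R by congr (P _ _); rewrite /w0; arith.
have base : at_least (d + 1) (P d w0 :|: R).
  have d1 : 1 < d + 1 by arith.
  by have := growth_end xy d1 qd qends; rewrite !addrK eR.
have RT : R \subset P m w.
  apply/subsetP=> r rR; apply: contraT => rT.
  have /maxv : A v.+1; last by rewrite ltnn.
  apply/existsP; exists r; rewrite in_setD rT /=; apply/andP; split.
    apply: (subsetP _ r rR); apply: (P_ends (t := v.+1) yx); last by arith.
    by rewrite /d; arith.
  by move: rR; congr (_ \in P _ _); rewrite /d; arith.
have RU : R \subset P (d + 1) (w0 + x) by rewrite -eR; apply: (P_end yx); arith.
have hb (t : nat) : (t < v)%N -> hole_bound (d + t%:Z) (w0 + t%:Z * y).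
  by move=> tv; have [|//] := IH (d + t%:Z) (w0 + t%:Z * y); rewrite /d; arith.
have fl (t : nat) : (t < v)%N ->
    P (d + t%:Z) (w0 + t%:Z * y) = P (d + t%:Z + 1) (w0 + t%:Z * y + y) ->
    at_least (d + t%:Z + 2) (P (d + t%:Z) (w0 + t%:Z * y)).
  move=> tv flat.
  have [eX|nX] := eqVneq (P (d + t%:Z) (w0 + t%:Z * y)) (P m w).
    rewrite eX; suff : at_least (m + 1) (P m w) by apply: at_least_le; rewrite /d; arith.
    have ey : P (m - 1) (w - y) = P m w.
      apply/eqP; rewrite eqEsubset (P_end yx) //=; try arith.
      rewrite -eX; apply: (P_ends (t := (v - t).-1) yx); first by rewrite /d; arith.
      have -> : (v - t).-1%:Z = v%:Z - t%:Z - 1 by arith.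
      by rewrite /w0; arith.
    have [|hb2 _] := IH (m - 2) (w - D); first by arith.
    exact: (flat_both xy hb2 n0 (esym eT) ey qU qT).
  have jump' : P (d + t%:Z + (v - t)%N%:Z) (w0 + t%:Z * y + (v - t)%N%:Z * y)
      != P (d + t%:Z) (w0 + t%:Z * y).
    have -> : (v - t)%N%:Z = v%:Z - t%:Z by arith.
    by apply: contraNneq nX => <-; apply/eqP; congr (P _ _); rewrite /d /w0; arith.
  have Xt0 : P (d + t%:Z) (w0 + t%:Z * y) != set0.
    have /set0Pn[r rX] := X0; apply/set0Pn; exists r.
    by apply: (subsetP _ r rX); apply: (P_ends (t := t) yx).
  apply: (flat_jump yx Xt0 flat jump') => j jv.
  have [|_ //] := IH (d + t%:Z + j%:Z) (w0 + t%:Z * y + j%:Z * y).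
  by rewrite /d; arith.
have := ladder yx RU base hb fl (leqnn v).
have -> : P (d + v%:Z) (w0 + v%:Z * y) = P m w.
  by congr (P _ _); rewrite /d /w0; arith.
by rewrite (setUidPl RT); apply: at_least_le; rewrite /d; arith.
Qed.

(** The same climb as in [flat_step], for a hole [q] that survives the removal of
the largest number [k] of copies of [x].  A flat step on the way is always
followed by a change: [q] is absent from all the sets of the ladder, and is
gained when [x] is added once more to [P m w].  This may be a change in degree
[m], hence the second hypothesis. *)
Lemma hole_step (m w : int) :
    (forall m' w' : int, m' < m -> hole_bound m' w' /\ flat_bound m' w') ->
    (forall w', flat_bound m w') ->
  hole_bound m w.
Proof.
move=> IH fbm x y xy h0; have yx := end_pairC xy.
pose H := holes m w.
have inH r : (r \in H) = [&& r \in P (m + 1) (w + x), r \in P (m + 1) (w + y) & r \notin P m w].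
  exact: in_holes.
have m0 : 0 <= m + 1 by case/set0Pn: h0 => r; rewrite inH inE => /and3P[/sums_ge0].
pose A k := [exists q in H, q \in P (m + 1 - k%:Z) (w + y - k%:Z * x)].
have exA : exists k, A k.
  case/set0Pn: h0 => r rH; exists 0%N; apply/existsP; exists r.
  by rewrite rH /= mul0r !subr0; move: rH; rewrite inH => /and3P[].
have boundA k : A k -> (k <= `|(m + 1)%R|)%N.
  by case/existsP=> q /andP[_]; rewrite inE => /sums_ge0; arith.
case: (ex_maxnP exA boundA) => k /existsP[q /andP[]].
move=> qH qk maxk; have := qH; rewrite inH => /and3P[qx qy qm].
pose d := m - k%:Z; pose w0 := w - k%:Z * x.
pose R := P d (w + y - k.+1%:Z * x).
have subP (t : nat) : (t <= k)%N -> P (d + t%:Z) (w0 + t%:Z * x) \subset P m w.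
  move=> tk; apply: (P_ends (t := k - t) xy); first by rewrite /d; arith.
  have -> : (k - t)%N%:Z = k%:Z - t%:Z by arith.
  by rewrite /w0; arith.
have qends : q \notin ends (d + 1) (w0 + y).
  rewrite (endsE _ _ yx) in_setU negb_or; apply/andP; split.
    apply: contraNN qm => qP; apply: (subsetP (subP 0%N isT)).
    by move: qP; congr (_ \in P _ _); arith.
  apply/negP => qP; have /maxk : A k.+1; last by rewrite ltnn.
  apply/existsP; exists q; rewrite qH /=.
  by move: qP; congr (_ \in P _ _); rewrite /d /w0; arith.
have qd : q \in P (d + 1) (w0 + y).
  by move: qk; congr (_ \in P _ _); rewrite /d /w0; arith.
have q0 : 0 <= (q : nat)%:Z by [].
have qN : (q : nat)%:Z < N%:Z by have := ltn_ord q; arith.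
have [d_gt0 X0] : 0 < d /\ P d w0 != set0.
  have /inner_bound qb := ends_inner qd qends.
  have := qx; rewrite inE => /sums_bound pb.
  move: qb pb; rewrite /w0 /d; case: xy => [[-> ->]|[-> ->]] qb pb.
    have D0 := N_le.
    have d1 : 0 < m - k%:Z by nia.
    by split=> //; apply: P_neq0; lia.
  have D0 := N_le.
  have d1 : 0 < m - k%:Z by nia.
  by split=> //; apply: P_neq0; lia.
have eR : P d (w0 + y - x) = R by congr (P _ _); rewrite /w0; arith.
have base : at_least (d + 1) (P d w0 :|: R).
  have d1 : 1 < d + 1 by arith.
  by have := growth_end yx d1 qd qends; rewrite !addrK eR.
have Ry : R \subset P (m + 1) (w + y).
  by apply: (P_ends (t := k.+1) xy); rewrite ?/d; arith.
have RH r : r \in R -> r \notin H.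
  move=> rR; apply/negP=> rH.
  have /maxk : A k.+1; last by rewrite ltnn.
  by apply/existsP; exists r; rewrite rH /=; move: rR; congr (_ \in P _ _); rewrite /d; arith.
have RU : R \subset P (d + 1) (w0 + y) by rewrite -eR; apply: (P_end xy); arith.
have hb (t : nat) : (t < k)%N -> hole_bound (d + t%:Z) (w0 + t%:Z * x).
  by move=> tk; have [|//] := IH (d + t%:Z) (w0 + t%:Z * x); rewrite /d; arith.
have fl (t : nat) : (t < k)%N ->
    P (d + t%:Z) (w0 + t%:Z * x) = P (d + t%:Z + 1) (w0 + t%:Z * x + x) ->
    at_least (d + t%:Z + 2) (P (d + t%:Z) (w0 + t%:Z * x)).
  move=> tk flat.
  have jump : P (d + t%:Z + (k.+1 - t)%N%:Z) (w0 + t%:Z * x + (k.+1 - t)%N%:Z * x)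
      != P (d + t%:Z) (w0 + t%:Z * x).
    have -> : (k.+1 - t)%N%:Z = k%:Z + 1 - t%:Z by arith.
    have qt : q \notin P (d + t%:Z) (w0 + t%:Z * x).
      by apply: contraNN qm; apply: (subsetP (subP t (ltnW tk))).
    apply: contraNneq qt => <-.
    by move: qx; congr (_ \in P _ _); rewrite /d /w0; arith.
  have Xt0 : P (d + t%:Z) (w0 + t%:Z * x) != set0.
    have /set0Pn[r rX] := X0; apply/set0Pn; exists r.
    by apply: (subsetP _ r rX); apply: (P_ends (t := t) xy).
  apply: (flat_jump xy Xt0 flat jump) => j jk.
  have [jk'|jk'] := ltnP (t + j) k.
    have [|_ //] := IH (d + t%:Z + j%:Z) (w0 + t%:Z * x + j%:Z * x).
    by rewrite /d; arith.
  have -> : d + t%:Z + j%:Z = m by rewrite /d; arith.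
  exact: fbm.
have := ladder xy RU base hb fl (leqnn k).
have -> : P (d + k%:Z) (w0 + k%:Z * x) = P m w.
  by congr (P _ _); rewrite /d /w0; arith.
have sub : P m w :|: R \subset P (m + 1) (w + y) :\: H.
  apply/subsetP=> r; rewrite in_setU in_setD => /orP[rP|rR].
    by rewrite inH rP !andbF /=; apply: (subsetP (P_end yx (erefl _) (erefl _))).
  by rewrite RH //=; apply: (subsetP Ry).
have := subset_leq_card sub; rewrite /at_least -/H /d.
move: #|_ :|: _| #|_ :\: _| => c1 c2; arith.
Qed.

Lemma hole_flat_bounds (m w : int) : hole_bound m w /\ flat_bound m w.
Proof.
suff H (n : nat) (m' w' : int) : m' < n%:Z -> hole_bound m' w' /\ flat_bound m' w'.
  by apply: (H `|m|.+1); lia.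
elim: n m' w' => [|n IHn] m' w' mn.
  have P0 w1 : P m' w1 = set0 by apply: P_neg; lia.
  split=> x y xy; last by rewrite P0 eqxx.
  move=> _; rewrite /at_least; lia.
have IH (m1 w1 : int) : m1 < m' -> hole_bound m1 w1 /\ flat_bound m1 w1.
  by move=> lt; apply: IHn; lia.
have fb w1 : flat_bound m' w1 by apply: flat_step.
by split=> //; apply: hole_step.
Qed.

(** * The two facts on sums of many exponents *)

Lemma missing_card (T : {set 'I_N}) (o : 'I_N) : o \notin T -> (#|T| < N)%N.
Proof.
move=> oT; rewrite -[X in (_ < X)%N]card_ord -cardsT; apply: proper_card.
by rewrite properT; apply: contraNneq oT => ->; rewrite in_setT.
Qed.

(** Take [q = 0] in [growth]: in degree [N] or more, [ends m w] would be the
whole window. *)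
Lemma sums_end (m w : int) : N%:Z <= m -> sums m w ->
  sums (m - 1) w \/ sums (m - 1) (w - D).
Proof.
move=> Nm sm; have l0 : (0 < l)%N by lia.
have m1 : 1 < m by have := gap_le l0; have := a_incr l0; lia.
have N0 : (0 < N)%N by have := gap_le l0; have := a_incr l0; lia.
pose o : 'I_N := Ordinal N0.
have oP : o \in P m w by rewrite inE /= subr0.
have [|oT] := boolP (o \in ends m w); first by rewrite !inE /= !subr0 => /orP.
have xy : end_pair 0 D by left.
have := growth_end xy m1 oP oT; rewrite -(endsE _ _ xy).
by have := missing_card oT; rewrite /at_least; move: #|_| => c; lia.
Qed.

(** Otherwise the point [0] of the window is a hole. *)
Lemma sums_both (m w : int) : N%:Z < m -> sums (m - 1) w -> sums (m - 1) (w - D) ->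
  sums (m - 2) (w - D).
Proof.
move=> Nm s0 sD; have l0 : (0 < l)%N by lia.
have N0 : (0 < N)%N by have := gap_le l0; have := a_incr l0; lia.
pose o : 'I_N := Ordinal N0; apply: contraT => sm.
have xy : end_pair 0 D by left.
have oH : o \in holes (m - 2) (w - D).
  rewrite (in_holes _ _ _ xy) addr0 subrK.
  have -> : m - 2 + 1 = m - 1 by lia.
  by rewrite !inE /= !subr0 sm sD s0.
have H0 : holes (m - 2) (w - D) != set0 by apply/set0Pn; exists o.
have [hb _] := hole_flat_bounds (m - 2) (w - D).
have := hb _ _ xy H0; rewrite /at_least.
have oN : o \notin P (m - 2 + 1) (w - D + D) :\: holes (m - 2) (w - D).
  by rewrite in_setD oH.
by have := missing_card oN; move: #|_| => c; lia.
Qed.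

End Sumsets.

(** * Binomials of small degree *)

Section IdealGen.

Variables (R : comNzRingType) (G : R -> Prop).

Lemma ideal_gen0 : ideal_gen G 0.
Proof. by exists 0%N, (fun=> 0), (fun=> 0); split=> [[]|]; rewrite ?big_ord0. Qed.

Lemma ideal_gen_in g : G g -> ideal_gen G g.
Proof.
by move=> Gg; exists 1%N, (fun=> 1), (fun=> g); split=> //; rewrite big_ord1 mul1r.
Qed.

Lemma ideal_genD x y : ideal_gen G x -> ideal_gen G y -> ideal_gen G (x + y).
Proof.
move=> [m1 [c1 [g1 [G1 ->]]]] [m2 [c2 [g2 [G2 ->]]]].
exists (m1 + m2)%N, (fun i => match split i with inl j => c1 j | inr j => c2 j end),
  (fun i => match split i with inl j => g1 j | inr j => g2 j end); split.
  by move=> i; case: (split i).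
rewrite big_split_ord /=; congr (_ + _); apply: eq_bigr => i _.
  by rewrite (unsplitK (inl i)).
by rewrite (unsplitK (inr i)).
Qed.

Lemma ideal_genM c x : ideal_gen G x -> ideal_gen G (c * x).
Proof.
move=> [m [c1 [g1 [G1 ->]]]]; exists m, (fun i => c * c1 i), g1; split=> //.
by rewrite mulr_sumr; apply: eq_bigr => i _; rewrite mulrA.
Qed.

Lemma ideal_gen_sum (I : eqType) (r : seq I) (F : I -> R) :
  (forall i, i \in r -> ideal_gen G (F i)) -> ideal_gen G (\sum_(i <- r) F i).
Proof.
move=> GF; rewrite big_seq; apply: (big_ind (ideal_gen G)) => //.
  exact: ideal_gen0.
exact: ideal_genD.
Qed.

End IdealGen.

Section Fibres.

Variables (l : nat) (a : nat -> int) (N : nat).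
Hypothesis l_gt1 : (1 < l)%N.
Hypothesis a0 : a 0%N = 0.
Hypothesis a_incr : forall i, (i < l)%N -> a i < a i.+1.
Hypothesis two_gaps : forall i j, (i < l)%N -> (j < l)%N -> i != j ->
  (a i.+1 - a i) + (a j.+1 - a j) <= N%:Z.
Hypothesis N_le : N%:Z <= a l.
Variable k : fieldType.

Local Notation mon := 'X_{1..l.+1}.

Definition weight (m : mon) : int := \sum_(i < l.+1) (m i)%:Z * a i.

Lemma weightD m m' : weight (m + m') = weight m + weight m'.
Proof.
by rewrite -big_split; apply: eq_bigr => i _; rewrite mnmDE PoszD mulrDl.
Qed.

Lemma weight1 i : weight U_(i) = a i.
Proof.
rewrite /weight (bigD1 i) //= mnm1E eqxx mul1r big1 ?addr0 // => j ji.
by rewrite mnm1E eq_sym (negPf ji) mul0r.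
Qed.

Lemma mon_var (m : mon) d : mdeg m = d.+1 -> exists i, (0 < m i)%N.
Proof.
move=> dm; apply/existsP; apply: contraTT isT; rewrite negb_exists => /forallP m0.
suff : mdeg m = 0%N by rewrite dm.
by rewrite mdegE big1 // => i _; apply/eqP; rewrite -leqn0 leqNgt.
Qed.

Lemma sums_mon (m : mon) : sums l a (mdeg m) (weight m).
Proof.
elim: {m}(mdeg m) {-2}m (erefl (mdeg m)) => [|d IHd] m dm.
  move/eqP: dm; rewrite mdeg_eq0 => /eqP ->.
  by rewrite mdeg0 /weight big1 // => i _; rewrite mnm0E mul0r.
have [i mi] := mon_var dm.
have em : m = (U_(i) + (m - U_(i)))%MM.
  by rewrite addmC submK // lep1mP -lt0n.
have dm' : mdeg (m - U_(i))%MM = d.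
  by move: dm; rewrite {1}em mdegD mdeg1; lia.
rewrite dm {1}em weightD weight1; apply/existsP; exists i.
have := IHd _ dm'; rewrite dm' [a i + _]addrC addrK; exact.
Qed.

Lemma mon_sums (d : nat) w : sums l a d w ->
  exists m : mon, mdeg m = d /\ weight m = w.
Proof.
elim: d w => [|d IHd] w.
  move=> /eqP ->; exists 0%MM; split; first exact: mdeg0.
  by rewrite /weight big1 // => i _; rewrite mnm0E mul0r.
case/existsP=> i /IHd[m [dm wm]]; exists (U_(i) + m)%MM.
by rewrite mdegD mdeg1 dm weightD weight1 wm; split=> //; lia.
Qed.

Definition small_binomial (g : {mpoly k[l.+1]}) : Prop :=
  exists m m' : mon, [/\ (mdeg m <= N)%N, mdeg m = mdeg m',
    weight m = weight m' & g = 'X_[m] - 'X_[m']].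

Local Notation linked m m' := (ideal_gen small_binomial ('X_[m] - 'X_[m'])).

Lemma linked_trans m2 m1 m3 : linked m1 m2 -> linked m2 m3 -> linked m1 m3.
Proof. by move=> h1 h2; have := ideal_genD h1 h2; rewrite addrA subrK. Qed.

Lemma linked_sym m1 m2 : linked m1 m2 -> linked m2 m1.
Proof. by move/(ideal_genM (-1)); rewrite mulN1r opprB. Qed.

(** Monomials with a common variable are linked by induction on the degree.
[sums_end] links every monomial to one that contains the first or the last
variable, through the variable that was set aside.  If one monomial contains
the first variable and the other the last, [sums_both] provides a monomial that
shares the first variable with one and the last with the other. *)
Lemma fibre_connected (m m' : mon) : mdeg m = mdeg m' -> weight m = weight m' ->
  linked m m'.
Proof.
elim: {m}(mdeg m) {-2}m (erefl (mdeg m)) m' => [|d IHd] m dm m' dm' wm'.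
  by apply: ideal_gen_in; exists m, m'; split=> //; rewrite dm.
have [dN|Nd] := leqP d.+1 N.
  by apply: ideal_gen_in; exists m, m'; split=> //; rewrite dm.
have N2 : (1 < N)%N.
  have l0 : (0 < l)%N by lia.
  by have := two_gaps l0 l_gt1 isT; have := a_incr l0; have := a_incr l_gt1; lia.
have share i (p q : mon) : (0 < p i)%N -> (0 < q i)%N -> mdeg p = d.+1 ->
    mdeg q = d.+1 -> weight p = weight q -> linked p q.
  move=> pi qi dp dq wpq.
  have ep : p = (U_(i) + (p - U_(i)))%MM by rewrite addmC submK // lep1mP -lt0n.
  have eq : q = (U_(i) + (q - U_(i)))%MM by rewrite addmC submK // lep1mP -lt0n.
  rewrite ep eq !mpolyXD -mulrBr; apply: ideal_genM; apply: IHd.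
  - by move: dp; rewrite {1}ep mdegD mdeg1; lia.
  - by move: dp dq; rewrite {1}ep {1}eq !mdegD !mdeg1; lia.
  by move: wpq; rewrite {1}ep {1}eq !weightD => /addrI.
pose last : 'I_l.+1 := ord_max.
pose first : 'I_l.+1 := ord0.
have to_end (p : mon) : mdeg p = d.+1 ->
    exists q : mon, [/\ mdeg q = d.+1, weight q = weight p, linked p q &
      (0 < q first)%N \/ (0 < q last)%N].
  move=> dp; have [i pi] := mon_var dp.
  have ep : p = (U_(i) + (p - U_(i)))%MM by rewrite addmC submK // lep1mP -lt0n.
  have dp' : mdeg (p - U_(i))%MM = d by move: dp; rewrite {1}ep mdegD mdeg1; lia.
  have sp := sums_mon (p - U_(i))%MM; rewrite dp' in sp.
  have ed : (d : int) - 1 = d.-1 by lia.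
  have mk (e : 'I_l.+1) (r : mon) : mdeg r = d.-1 ->
      weight r + a e = weight (p - U_(i))%MM ->
      exists q : mon, [/\ mdeg q = d.+1, weight q = weight p, linked p q & (0 < q e)%N].
    move=> dr wr; pose q := (U_(i) + (U_(e) + r))%MM.
    have dq : mdeg q = d.+1 by rewrite !mdegD !mdeg1 dr; lia.
    have wq : weight q = weight p.
      by rewrite [in RHS]ep !weightD !weight1 [a e + _]addrC wr.
    exists q; split=> //; last by rewrite !mnmDE !mnm1E eqxx; lia.
    by apply: (share i) => //; rewrite !mnmDE !mnm1E eqxx; lia.
  have Nd' : N%:Z <= (d : int) by lia.
  case: (sums_end l_gt1 a0 a_incr two_gaps N_le Nd' sp); rewrite ed => /mon_sums[r [dr wr]].
    have [|q [dq wq lq qe]] := mk first r dr; first by rewrite wr a0 addr0.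
    by exists q; split=> //; left.
  have [|q [dq wq lq qe]] := mk last r dr; first by rewrite wr subrK.
  by exists q; split=> //; right.
have mixed (p q : mon) : mdeg p = d.+1 -> mdeg q = d.+1 -> weight p = weight q ->
    (0 < p first)%N -> (0 < q last)%N -> linked p q.
  move=> dp dq wpq pf ql.
  have ep : p = (U_(first) + (p - U_(first)))%MM by rewrite addmC submK // lep1mP -lt0n.
  have eq : q = (U_(last) + (q - U_(last)))%MM by rewrite addmC submK // lep1mP -lt0n.
  have dp' : mdeg (p - U_(first))%MM = d by move: dp; rewrite {1}ep mdegD mdeg1; lia.
  have dq' : mdeg (q - U_(last))%MM = d by move: dq; rewrite {1}eq mdegD mdeg1; lia.
  have sp := sums_mon (p - U_(first))%MM; have sq := sums_mon (q - U_(last))%MM.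
  rewrite dp' in sp; rewrite dq' in sq.
  have wp : weight p = weight (p - U_(first))%MM by rewrite {1}ep weightD weight1 a0 add0r.
  have wq : weight p - a l = weight (q - U_(last))%MM.
    by rewrite wpq {1}eq weightD weight1 [a _ + _]addrC addrK.
  rewrite -wp in sp; rewrite -wq in sq.
  have Nd' : N%:Z < (d.+1 : int) by lia.
  have e1 : (d.+1 : int) - 1 = d by lia.
  have := sums_both l_gt1 a0 a_incr two_gaps N_le Nd'; rewrite e1 => /(_ _ sp sq).
  have -> : (d.+1 : int) - 2 = d.-1 by lia.
  case/mon_sums=> r [dr wr]; pose t := (U_(first) + (U_(last) + r))%MM.
  have dt : mdeg t = d.+1 by rewrite !mdegD !mdeg1 dr; lia.
  have wt : weight t = weight p by rewrite !weightD !weight1 a0 wr add0r addrC subrK.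
  apply: (linked_trans (m2 := t)).
    by apply: (share first) => //; rewrite !mnmDE !mnm1E eqxx; lia.
  apply: (share last) => //; last by rewrite wt.
  by rewrite !mnmDE !mnm1E eqxx; lia.
have [p [dp wp lp pe]] := to_end m dm.
have [q [dq wq lq qe]] := to_end m' (etrans (esym dm') dm).
apply: (linked_trans lp); apply: linked_trans (linked_sym lq).
have wpq : weight p = weight q by rewrite wp wq.
case: pe qe => [pf|pl] [qf|ql].
- exact: (share first).
- exact: mixed.
- by apply: linked_sym; apply: mixed.
exact: (share last).
Qed.

End Fibres.

(** * The kernel of the toric map *)

Section Kernel.

Variables (k : fieldType) (n : nat) (a : n.-tuple int).

Local Notation mon := 'X_{1..n}.
Local Notation psi := (@toric_map k n a).

HB.instance Definition _ :=
  GRing.isZmodMorphism.Build {mpoly k[n]} (ratfun k) psi (@toric_map_zmod_morphism k n a).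
HB.instance Definition _ :=
  GRing.isMonoidMorphism.Build {mpoly k[n]} (ratfun k) psi (@toric_map_monoid_morphism k n a).

Definition toric_weight (m : mon) : int := \sum_(i < n) (m i)%:Z * tnth a i.

Lemma toric_map_mon (m : mon) : psi 'X_[m] = y1 k ^+ mdeg m * y2 k ^ toric_weight m.
Proof.
have y2_expD : {morph (fun z : int => y2 k ^ z) : x y / x + y >-> x * y}.
  by move=> x y; rewrite expfzDr ?y2_neq0.
rewrite mpolyXE_id rmorph_prod mdegE expr_sum (big_morph _ y2_expD (expr0z _)) -big_split.
apply: eq_bigr => i _; rewrite rmorphXn /= toric_mapX exprMn; congr (_ * _).
by rewrite exprnP exprz_exp mulrC.
Qed.

Lemma toric_map_sum (p : {mpoly k[n]}) :
  psi p = \sum_(m <- msupp p) tofrac (p@_m)%:MP_[2] * (y1 k ^+ mdeg m * y2 k ^ toric_weight m).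
Proof.
rewrite {1}[p]mpolyE raddf_sum; apply: eq_bigr => m _.
by rewrite -mul_mpolyC [LHS](rmorphM psi) /= toric_mapC toric_map_mon.
Qed.

(** Distinct monomials in [y1] and [y2] are linearly independent; multiplying by
a power of [y2] makes all exponents nonnegative, so that this can be read off
the coefficients of a polynomial. *)
Lemma toric_kernel_uniq (p : {mpoly k[n]}) :
    (forall m m', m \in msupp p -> m' \in msupp p -> mdeg m = mdeg m' ->
       toric_weight m = toric_weight m' -> m = m') ->
  psi p = 0 -> p = 0.
Proof.
move=> inj p0; pose M := (\sum_(m <- msupp p) `|toric_weight m|)%N.
have Mge m : m \in msupp p -> 0 <= toric_weight m + M%:Z.
  move=> mp; have : (absz (toric_weight m) <= M)%N by rewrite /M (big_rem m mp) leq_addr.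
  lia.
pose e (m : mon) := (U_(inord 0 : 'I_2) *+ mdeg m + U_(inord 1) *+ absz (toric_weight m + M%:Z)%R)%MM.
pose Q : {mpoly k[2]} := \sum_(m <- msupp p) p@_m *: 'X_[e m].
have Q0 : Q = 0.
  apply/eqP; rewrite -tofrac_eq0; apply/eqP; rewrite -(mul0r (y2 k ^+ M)) -p0.
  rewrite toric_map_sum mulr_suml rmorph_sum /= big_seq [RHS]big_seq; apply: eq_bigr => m mp.
  rewrite -mul_mpolyC rmorphM -mulrA /e mpolyXD rmorphM -!mpolyXn !rmorphXn /=.
  congr (_ * _); rewrite -mulrA; congr (_ * _).
  by rewrite [in RHS]exprnP -expfzDr ?y2_neq0 // exprnP gez0_abs ?Mge.
have e_inj m m' : m \in msupp p -> m' \in msupp p -> e m = e m' -> m = m'.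
  move=> mp m'p emm'; have neq : (inord 0 : 'I_2) != inord 1.
    by rewrite -val_eqE /= !inordK.
  have eE (x : mon) : e x (inord 0) = mdeg x /\ e x (inord 1) = absz (toric_weight x + M%:Z).
    by rewrite /e !mnmDE !mulmnE !mnm1E !eqxx eq_sym (negPf neq) !mul0n ?mul1n addn0 add0n.
  have [d1 w1] := eE m; have [d2 w2] := eE m'; rewrite emm' in d1 w1.
  apply: inj => //; first by rewrite -d1 d2.
  by have := Mge m mp; have := Mge m' m'p; lia.
apply/eqP; rewrite -msupp_eq0; apply: contraT.
case sp: (msupp p) => [//|m s] _; have mp : m \in msupp p by rewrite sp mem_head.
have := mcoeff_msupp p m; rewrite mp => /esym.
suff -> : p@_m = 0 by rewrite eqxx.
have := congr1 (mcoeff (e m)) Q0; rewrite mcoeff0 /Q raddf_sum (bigD1_seq m mp (msupp_uniq p)) /=.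
rewrite mcoeffZ mcoeffX eqxx mulr1 big_seq_cond big1 ?addr0 // => m' /andP[m'p m'm].
rewrite mcoeffZ mcoeffX; have [ee|_] := eqVneq; last by rewrite mulr0.
by move: m'm; rewrite (e_inj _ _ m'p mp ee) eqxx.
Qed.

Definition same_image (m m' : mon) : bool :=
  (mdeg m' == mdeg m) && (toric_weight m' == toric_weight m).

(** One monomial for each value of the toric map. *)
Definition canon_mon (m : mon) : mon := choose (same_image m) m.

Lemma canon_monP (m : mon) :
  mdeg (canon_mon m) = mdeg m /\ toric_weight (canon_mon m) = toric_weight m.
Proof.
have mm : same_image m m by rewrite /same_image !eqxx.
by have /andP[/eqP-> /eqP->] := chooseP mm.
Qed.

Lemma canon_mon_eq (m m' : mon) : mdeg m = mdeg m' ->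
  toric_weight m = toric_weight m' -> canon_mon m = canon_mon m'.
Proof.
move=> dm wm; have mm' : same_image m =1 same_image m'.
  by move=> x; rewrite /same_image dm wm.
rewrite /canon_mon (eq_choose mm'); apply: choose_id.
  by rewrite /same_image dm wm !eqxx.
by rewrite /same_image !eqxx.
Qed.

(** Modulo the linked binomials every monomial equals its canonical one, and a
combination of canonical monomials in the kernel is zero. *)
Lemma toric_kernel (G : {mpoly k[n]} -> Prop) (p : {mpoly k[n]}) :
    (forall g, G g -> psi g = 0) ->
    (forall m m' : mon, mdeg m = mdeg m' -> toric_weight m = toric_weight m' ->
       ideal_gen G ('X_[m] - 'X_[m'])) ->
  toric_ideal a p <-> ideal_gen G p.
Proof.
move=> G0 link; have gen0 q : ideal_gen G q -> psi q = 0.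
  move=> [s [c [g [Gg ->]]]]; rewrite raddf_sum big1 // => i _.
  by rewrite [LHS](rmorphM psi) /= (G0 _ (Gg i)) mulr0.
split=> [p0|]; last exact: gen0.
pose q : {mpoly k[n]} := \sum_(m <- msupp p) p@_m *: 'X_[canon_mon m].
have pq : ideal_gen G (p - q).
  rewrite [X in X - _](mpolyE p) -sumrB; apply: ideal_gen_sum => m _.
  rewrite -scalerBr -mul_mpolyC; apply: ideal_genM.
  by have [dm wm] := canon_monP m; apply: link.
suff q0 : q = 0 by move: pq; rewrite q0 subr0.
apply: toric_kernel_uniq; last first.
  by have := gen0 _ pq; rewrite raddfB /= [psi p]p0 sub0r => /eqP; rewrite oppr_eq0 => /eqP.
have canonq m : m \in msupp q -> exists m', m = canon_mon m'.
  move=> mq; have [/hasP[m' _ /eqP <-]|/hasPn nq] :=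
    boolP (has (fun m' => canon_mon m' == m) (msupp p)); first by exists m'.
  move: mq; rewrite mcoeff_msupp raddf_sum big_seq big1 ?eqxx // => m' m'p.
  by rewrite /= mcoeffZ mcoeffX (negPf (nq _ m'p)) mulr0.
move=> m m' /canonq[m1 ->] /canonq[m2 ->] dm wm.
have [d1 w1] := canon_monP m1; have [d2 w2] := canon_monP m2.
by apply: canon_mon_eq; rewrite -?d1 -?w1 ?dm ?wm.
Qed.

End Kernel.

(** * The two largest gaps *)

Section TopTwo.

Local Notation ge_int := (fun x y : int => y <= x).

Lemma sort_ge_sorted (s : seq int) : sorted ge_int (sort ge_int s).
Proof. by apply: sort_sorted => x y; apply: le_total. Qed.

Lemma sorted_ge_head (x y : int) (s : seq int) :
  sorted ge_int (x :: s) -> y \in x :: s -> y <= x.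
Proof.
move=> ss; rewrite inE => /orP[/eqP-> //|ys].
have tr : transitive ge_int by move=> z u v uz zv; apply: le_trans zv uz.
exact: (allP (order_path_min tr ss)).
Qed.

(** If the first entry is the maximum, the second is among the other entries and
so at most their maximum.  If not, the first is among the other entries. *)
Lemma nth_add_le_sort (s : seq int) (i j : nat) :
  (i < j < size s)%N -> s`_i + s`_j <= (sort ge_int s)`_0 + (sort ge_int s)`_1.
Proof.
move=> /andP[ij js]; have is_ := ltn_trans ij js.
pose u := take i s ++ drop i.+1 s.
have yu : s`_j \in u.
  rewrite mem_cat -[j](subnKC ij) -nth_drop mem_nth ?orbT //.
  by rewrite size_drop ltn_sub2r // (leq_ltn_trans ij js).
have su : perm_eq (sort ge_int s) (s`_i :: u).
  rewrite perm_sort -{1}(cat_take_drop i s) (drop_nth 0 is_).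
  by rewrite perm_catC /= perm_cons perm_catC.
have := sort_ge_sorted s; move: (sort _ s) su => t.
move: (s`_i) (s`_j) yu => x y yu; clearbody u.
case: t => [|t0 t] su ts; first by have := perm_size su.
have mem_t z : z \in x :: u -> z <= t0.
  by rewrite -(perm_mem su); apply: sorted_ge_head.
have tu : t != [::].
  by have := perm_size su; case: (t) => //=; case: (u) yu.
case: t tu su ts mem_t => [//|t1 t] _ su /andP[t01 ts] mem_t /=.
have [ex|nx] := eqVneq x t0.
  rewrite ex lerD2l; apply: (sorted_ge_head (x := t1) (s := t)) => //.
  by move: su; rewrite ex perm_cons => /perm_mem ->.
rewrite addrC lerD ?mem_t ?inE ?yu ?orbT //.
apply: (sorted_ge_head (x := t1) (s := t)) => //.
by have := perm_mem su x; rewrite !inE eqxx (negPf nx).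
Qed.

Lemma sort_top_two_le_sum (s : seq int) : (1 < size s)%N -> all (>= 0) s ->
  (sort ge_int s)`_0 + (sort ge_int s)`_1 <= \sum_(x <- s) x.
Proof.
move=> s2 s0; have st : perm_eq (sort ge_int s) s by rewrite perm_sort.
rewrite -(perm_big _ st) /=; rewrite -(perm_size st) in s2; rewrite -(perm_all _ st) in s0.
case: (sort _ s) s2 s0 => [|t0 [|t1 t]] //= _ /and3P[_ _ tge0].
rewrite !big_cons addrA lerDl big_seq; apply: sumr_ge0 => x xt.
exact: (allP tge0).
Qed.

End TopTwo.

Theorem theorem1 (k : fieldType) (n : nat) (hn : (3 <= n)%N)
    (a : n.-tuple int) (ha : sorted <%R a)
    (r s : int)
    (hr : r = (sorted_gaps a)`_0) (hs : s = (sorted_gaps a)`_1) :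
  exists G : {mpoly k[n]} -> Prop,
    (forall g, G g -> exists2 d : nat, d%:Z <= r + s & g \is d.-homog) /\
    (forall p : {mpoly k[n]}, toric_ideal a p <-> ideal_gen G p).
Proof.
case: n hn a ha hr hs => [//|l] hn a ha hr hs.
have l_gt1 : (1 < l)%N by [].
pose b (i : nat) : int := a`_i - a`_0.
have b0 : b 0%N = 0 by rewrite /b subrr.
have gap_b i : b i.+1 - b i = a`_i.+1 - a`_i by rewrite /b; lia.
have b_incr i : (i < l)%N -> b i < b i.+1.
  move=> il; rewrite -subr_gt0 gap_b subr_gt0.
  by move/(sortedP 0): ha; apply; rewrite size_tuple.
have size_gaps : size (gaps a) = l by rewrite size_map size_iota size_tuple.
have nth_gaps i : (i < l)%N -> (gaps a)`_i = b i.+1 - b i.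
  move=> il; rewrite gap_b (nth_map 0%N) ?size_iota ?size_tuple //.
  by rewrite nth_iota ?size_tuple.
have pair_le i j : (i < j < l)%N -> (b i.+1 - b i) + (b j.+1 - b j) <= r + s.
  move=> /andP[ij jl]; rewrite -!nth_gaps ?(ltn_trans ij jl) // hr hs.
  by apply: nth_add_le_sort; rewrite size_gaps ij.
have rs0 : 0 <= r + s.
  apply: le_trans (pair_le 0%N 1%N l_gt1).
  have := b_incr 0%N (ltnW l_gt1); have := b_incr 1%N l_gt1; lia.
pose N := absz (r + s).
have NE : N%:Z = r + s by rewrite gez0_abs.
have two_gaps i j : (i < l)%N -> (j < l)%N -> i != j ->
    (b i.+1 - b i) + (b j.+1 - b j) <= N%:Z.
  move=> il jl; rewrite neq_ltn NE => /orP[ij|ji]; first by apply: pair_le; rewrite ij.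
  by rewrite addrC; apply: pair_le; rewrite ji.
have N_le : N%:Z <= b l.
  have -> : b l = \sum_(x <- gaps a) x.
    by rewrite big_map size_tuple -[l.+1.-1]subn0 (telescope_sumr (fun i => a`_i)).
  rewrite NE hr hs; apply: sort_top_two_le_sum; first by rewrite size_gaps.
  apply/(all_nthP 0) => i; rewrite size_gaps => il.
  by rewrite nth_gaps // subr_ge0 ltW ?b_incr.
have weightE (m : 'X_{1..l.+1}) : toric_weight a m = weight b m + (mdeg m)%:Z * a`_0.
  rewrite /weight mdegE -natz natr_sum mulr_suml -big_split; apply: eq_bigr => i _.
  by rewrite /= natz -mulrDr subrK (tnth_nth 0).
exists (small_binomial b N (k := k)); split=> [g [m [m' [dN dm _ ->]]]|p].
  exists (mdeg m); first by rewrite -NE lez_nat.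
  by apply: rpredB; rewrite dhomogX //= dm.
apply: toric_kernel => [_ [m [m' [_ dm wm ->]]]|m m' dm wm].
  by apply/eqP; rewrite raddfB /= !toric_map_mon !weightE dm wm subrr.
apply: (fibre_connected l_gt1 b0 b_incr two_gaps N_le) => //.
by move: wm; rewrite !weightE dm => /addIr.
Qed.
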